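(* Let $\varepsilon>0$ be a constant and let $L^*(h,N)=hN^{1/h}$. \begin{enumerate} \item (Multiplicative error) For all sufficiently large $N$, there is a randomized algorithm that computes a shift connection schedule $\boldsymbol{\sigma}$ on $N$ nodes, which succeeds with probability at least $\tfrac12$ and whose success is efficiently (polynomial time in $N$) certifiable, such that when it succeeds, for each $h\in\{1,\dots,\log_2 N\}$ there exists an oblivious routing protocol on $\boldsymbol{\sigma}$ which guarantees throughput $\frac{1}{2h}(1-\varepsilon)$ and achieves maximum latency $\tilde{\mathcal{O}}(L^*(h,N))$. \item (Additive error) For all sufficiently large $N$, there is a randomized algorithm that computes a shift connection schedule $\boldsymbol{\sigma}$ on $N$ nodes, which succeeds with probability at least $\tfrac12$ and whose success is efficiently certifiable, such that when it succeeds, for each $h\in\{1,\dots,\log_2 N\}$ there exists an oblivious routing protocol on $\boldsymbol{\sigma}$ which guarantees throughput $\frac{1}{2h}-\varepsilon$ and achieves maximum latency $\mathcal{O}(L^*(h,N))$. \item (Deterministic, multiplicative error) For infinitely many $N$, there is a deterministic, efficiently computable algorithm that computes a shift connection schedule $\boldsymbol{\sigma}$ on $N$ nodes such that for each $h\in\{1,\dots,\log_2 N\}$ there exists an oblivious routing protocol on $\boldsymbol{\sigma}$ which guarantees throughput $\frac{1}{2h}(1-\varepsilon)$ and achieves maximum latency $\mathcal{O}(L^*(h,N)\cdot\log N)$. \end{enumerate} The constants hidden in $\mathcal{O}(\cdot)$ and $\tilde{\mathcal{O}}(\cdot)$ may depend on $\varepsilon$ but not on $N$ or $h$; $\tilde{\mathcal{O}}$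 additionally hides polylogarithmic factors in $N$.
   Context: A connection schedule on $N$ nodes with period $T$ is a sequence of permutations $\sigma_0,\dots,\sigma_{T-1}$ of the node set; indices are taken mod $T$, so at integer timestep $t$ the permutation $\sigma_{t\bmod T}$ is used. A shift connection schedule identifies the node set with $\mathbb{Z}/(N)$ and is given by shifts $s_0,\dots,s_{T-1}\in\mathbb{Z}/(N)$ with $\sigma_k(j)=j+s_k$. The virtual topology is the directed graph on vertex set $[N]\times\mathbb{Z}$ with virtual edges $(i,t)\to(i,t+1)$ and physical edges $(i,t)\to(\sigma_t(i),t+1)$. A flow is a nonnegative measure on the set of directed paths of this graph; it is $T$-periodic if invariant under shifting all times by $T$; the amount of flow on an edge is the total measure of paths containing it; a flow is feasible if every physical edge carries at most $1$ (virtual edges have unlimited capacity). An oblivious routing protocol is a $T$-periodic flow $R$ such that for every $(a,b,t)\in[N]\times[N]\times\mathbb{Z}$ the total flow on paths starting at $(a,t)$ and ending at some $(b,t')$ with $t'>t$ equals $1$. The latency of a path is its number of edges (virtual and physical); the maximum latency of $R$ is the maximum latency over paths with positive flow. A demand function is $D:[N]\times[N]\times\mathbb{Z}\to\mathbb{R}_{\ge 0}$; the induced flow $R^D$ assigns to each path $P$ starting at $(a,t)$ and ending at node $b$ the value $D(a,b,t)R(P)$. $R$ guarantees throughput $r$ if $R^D$ is feasible for every demand function $D$ with $\sum_b D(a,b,t)\le r$ and $\sum_b D(b,a,t)\le r$ for all $a\in[N]$, $t\in\mathbb{Z}$. *)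

(* Defs.v *)
(* MathComp / MathComp-Analysis. *)
From HB Require Import structures.
From mathcomp Require Import all_boot all_order all_fingroup all_algebra.
From mathcomp Require Import all_classical all_reals all_analysis.

Set Implicit Arguments.
Unset Strict Implicit.
Unset Printing Implicit Defensive.

Import Order.TTheory GRing.Theory Num.Theory.

Local Open Scope classical_set_scope.
Local Open Scope ring_scope.

Section Topology.
Variable V : finType.

(* The period of a connection schedule is the length of the list; only
   nonempty lists are meaningful. *)
Definition schedule := seq {perm V}.

Definition sched_perm (sigma : schedule) (t : int) : {perm V} :=
  nth 1%g sigma `|(t %% (size sigma)%:Z)%Z|%N.

Definition vertex := (V * int)%type.

(* An edge is given by its kind (true = physical, false = virtual) and its
   tail, so that a physical edge (i,t) -> (i,t+1) arising from a fixed point of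
   sigma_t is distinct from the parallel virtual edge. *)
Definition edge := (bool * vertex)%type.

Definition edge_head (sigma : schedule) (e : edge) : vertex :=
  let: (phys, (i, t)) := e in
  (if phys then sched_perm sigma t i else i, t + 1).

(* Every vertex has exactly one outgoing edge of each kind, so a finite
   directed path is given by its first vertex and the kinds of its edges. *)
Definition dpath := (vertex * seq bool)%type.

Fixpoint walk (sigma : schedule) (v : vertex) (ks : seq bool) : seq edge :=
  if ks is k :: ks' then (k, v) :: walk sigma (edge_head sigma (k, v)) ks'
  else [::].

Definition path_edges (sigma : schedule) (P : dpath) : seq edge :=
  walk sigma P.1 P.2.

Definition path_start (P : dpath) : vertex := P.1.

Definition path_end (sigma : schedule) (P : dpath) : vertex :=
  last P.1 [seq edge_head sigma e | e <- path_edges sigma P].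

Definition latency (P : dpath) : nat := size P.2.

Definition delay (T : int) (P : dpath) : dpath :=
  ((P.1.1, P.1.2 + T), P.2).

Section Flow.
Variable R : realType.

(* There are countably many paths: a measure on the set of all paths is given
   by the masses of single paths, and a set of paths has measure
   [\esum_(P in A) f P]. *)
Definition is_flow (f : dpath -> \bar R) : Prop := forall P, (0 <= f P)%E.

Definition periodic_flow (T : int) (f : dpath -> \bar R) : Prop :=
  forall P, f (delay T P) = f P.

Definition edge_flow (sigma : schedule) (f : dpath -> \bar R) (e : edge) :
    \bar R :=
  (\esum_(P in [set P | e \in path_edges sigma P]) f P)%E.

Definition feasible (sigma : schedule) (f : dpath -> \bar R) : Prop :=
  forall v : vertex, (edge_flow sigma f (true, v) <= 1)%E.

Definition oblivious_routing (sigma : schedule) (f : dpath -> \bar R) : Prop :=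
  [/\ is_flow f,
      periodic_flow (size sigma)%:Z f &
      forall (a b : V) (t : int),
        (\esum_(P in [set P | [/\ path_start P = (a, t),
                                  (path_end sigma P).1 = b &
                                  (t < (path_end sigma P).2)%R]]) f P = 1)%E].

Definition max_latency (f : dpath -> \bar R) : \bar R :=
  ereal_sup [set ((latency P)%:R)%:E | P in [set P | (0 < f P)%E]].

Definition induced_flow (sigma : schedule) (f : dpath -> \bar R)
    (D : V -> V -> int -> R) : dpath -> \bar R :=
  fun P => ((D (path_start P).1 (path_end sigma P).1 (path_start P).2)%:E
            * f P)%E.

Definition guarantees_throughput (sigma : schedule) (f : dpath -> \bar R)
    (r : R) : Prop :=
  forall D : V -> V -> int -> R,
    (forall a b t, 0 <= D a b t) ->
    (forall a t, \sum_(b : V) D a b t <= r) ->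
    (forall a t, \sum_(b : V) D b a t <= r) ->
    feasible sigma (induced_flow sigma f D).

End Flow.
End Topology.

(* 'Z_N is Z/(N) only for 1 < N, which is required wherever these are used. *)
Definition shift_perm (N : nat) (x : 'Z_N) : {perm 'Z_N} := perm (addIr x).

Definition shift_schedule (N : nat) (s : seq 'Z_N) : schedule 'Z_N :=
  [seq shift_perm x | x <- s].

Definition Lstar (R : realType) (h N : nat) : R :=
  h%:R * N%:R `^ (h%:R^-1).

Definition universal_tradeoff (R : realType) (N : nat) (s : seq 'Z_N)
    (thr lat : nat -> R) : Prop :=
  forall h : nat, (1 <= h <= trunc_log 2 N)%N ->
  exists f : dpath 'Z_N -> \bar R,
    [/\ oblivious_routing (shift_schedule s) f,
        guarantees_throughput (shift_schedule s) f (thr h) &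
        (max_latency f <= (lat h)%:E)%E].

(* Algorithms are programs of a random access machine whose only arithmetic is
   addition and truncated subtraction, at unit cost.  Polynomial time on this
   machine coincides with polynomial time on Turing machines (without
   multiplication, numbers of n bits take about n steps to build). *)
Inductive expr : Type :=
| EConst of nat
| ELoad of expr
| EAdd of expr & expr
| ESub of expr & expr.

Inductive cmd : Type :=
| CSkip
| CStore of expr & expr
| CSeq of cmd & cmd
| CIf of expr & cmd & cmd
| CWhile of expr & cmd.

Definition memory := nat -> nat.

Fixpoint eval (m : memory) (e : expr) : nat :=
  match e with
  | EConst n => n
  | ELoad e1 => m (eval m e1)
  | EAdd e1 e2 => (eval m e1 + eval m e2)%N
  | ESub e1 e2 => (eval m e1 - eval m e2)%N
  end.

Fixpoint ecost (e : expr) : nat :=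
  match e with
  | EConst _ => 1
  | ELoad e1 => (ecost e1).+1
  | EAdd e1 e2 | ESub e1 e2 => (ecost e1 + ecost e2).+1
  end.

(* [exec c m n m']: started in memory m, the command c halts after n steps in
   memory m'. *)
Inductive exec : cmd -> memory -> nat -> memory -> Prop :=
| exec_skip m : exec CSkip m 1 m
| exec_store e1 e2 m :
    exec (CStore e1 e2) m (ecost e1 + ecost e2).+1
      [eta m with eval m e1 |-> eval m e2]
| exec_seq c1 c2 m n1 m1 n2 m2 :
    exec c1 m n1 m1 -> exec c2 m1 n2 m2 -> exec (CSeq c1 c2) m (n1 + n2) m2
| exec_if e c1 c2 m n m' :
    exec (if eval m e != 0%N then c1 else c2) m n m' ->
    exec (CIf e c1 c2) m (ecost e + n).+1 m'
| exec_while_stop e c m :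
    eval m e = 0%N -> exec (CWhile e c) m (ecost e).+1 m
| exec_while_step e c m n1 m1 n2 m2 :
    eval m e != 0%N -> exec c m n1 m1 -> exec (CWhile e c) m1 n2 m2 ->
    exec (CWhile e c) m (ecost e + n1 + n2).+1 m2.

(* A list is stored as its length in cell 0 followed by its items. *)
Definition store_list (x : seq nat) : memory :=
  fun i => if i is j.+1 then nth 0%N x j else size x.

Definition read_list (m : memory) : seq nat := mkseq (fun i => m i.+1) (m 0%N).

(* The length of the output is charged to the running time, since the machine
   could otherwise announce an exponentially long list of untouched cells. *)
Definition computes_within (c : cmd) (x y : seq nat) (t : nat) : Prop :=
  exists (n : nat) (m : memory),
    [/\ exec c (store_list x) n m, read_list m = y & (n + size y <= t)%N].

Definition poly_bound (k N : nat) : nat := (N ^ k + k)%N.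

(* The sampler [A] reads N and a tape of independent fair coins and outputs a
   shift schedule; the checker [C] sees only N and that schedule, and decides
   whether the run is successful.  Both run in time polynomial in N.  The tape
   length is the time bound itself, so that it conveys no information beyond N. *)
Definition certified_random_schedule (A C : cmd) (k N : nat)
    (good : seq 'Z_N -> Prop) : Prop :=
  let tape := (poly_bound k N).-tuple bool in
  exists (out : tape -> seq 'Z_N) (success : {set tape}),
    [/\ forall r : tape, out r != [::] /\
          computes_within A (N :: [seq nat_of_bool b | b <- r])
            [seq nat_of_ord x | x <- out r] (poly_bound k N),
        forall r : tape,
          computes_within C (N :: [seq nat_of_ord x | x <- out r])
            [:: nat_of_bool (r \in success)] (poly_bound k N),
        (2^-1 <= #|success|%:R / #|{: tape}|%:R :> rat) &
        forall r : tape, r \in success -> good (out r)].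

Definition computed_schedule (A : cmd) (k N : nat) (good : seq 'Z_N -> Prop) :
    Prop :=
  exists s : seq 'Z_N,
    [/\ s != [::],
        computes_within A [:: N] [seq nat_of_ord x | x <- s] (poly_bound k N) &
        good s].

(* Main.v *)
From mathcomp Require Import all_boot all_order all_fingroup all_algebra.
From mathcomp Require Import all_classical all_reals all_analysis.
From mathcomp Require Import zify lra ring.
Require Import Defs.

(** One explicit schedule proves all three parts, so the sampler ignores its
coins and the checker accepts every run.  Time runs through pairs (v, rho) of a
counter v and a row rho, and the shift at (v, rho) with rho < R is the number
whose base-Q digits are those of v rotated by rho places (mod N), where Q ^ R
exceeds N by a large constant factor.

In a window where the low w digits of v take all values once, choosing one time
in each of h rows whose places together cover all R places makes the sum of the
chosen shifts nearly uniform on Z/(N), and averaging over the starting row loads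
all times equally.  Valiant load balancing, with a random intermediate node
reached in one window and the destination in the next one, then loads each edge
by 2h(1 + o(1)) per unit of demand.  The latency is about R Q ^ (R / h): with
Q = 2 and R about log N this is N ^ (1 / h) log N, and with R constant and
divisible by h it is O(N ^ (1 / h)).  An extra row R runs through the powers of
two; it connects all nodes in time O(log N) = O(h N ^ (1 / h)), which settles
the h for which the additive bound on the throughput is not positive. *)

Set Implicit Arguments.
Unset Strict Implicit.
Unset Printing Implicit Defensive.
Import Order.TTheory GRing.Theory Num.Theory.
Local Open Scope ring_scope.

(** * Oblivious routing on a shift schedule from uniform samples of shifts *)

Local Open Scope classical_set_scope.

(** Passes from sums over the countable set of paths to finite sums: on [A] the flow vanishes off
    the image of [psi], and injectivity counts each path once. *)
Lemma esum_inj_fin (R : realType) (T : choiceType) (F : finType) (psi : F -> T)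
    (A : set T) (f : T -> \bar R) (g : F -> R) (Q : pred F) :
  injective psi -> (forall P, (0 <= f P)%E) ->
  (forall x, f (psi x) = (g x)%:E) ->
  (forall x, A (psi x) <-> Q x) ->
  (forall P, A P -> f P != 0%E -> exists x, P = psi x) ->
  (\esum_(P in A) f P = (\sum_(x | Q x) g x)%:E)%E.
Proof.
move=> inj_psi f0 fg AQ supp.
pose B : set T := psi @` [set` Q].
have BA : B `<=` A by move=> _ [x /= Qx <-]; apply/AQ.
rewrite (esumID B) //; rewrite [X in (_ + X)%E]esum1 ?adde0; last first.
  move=> P [AP nBP]; apply/eqP/negPn/negP => fP; apply: nBP.
  have [x Px] := supp _ AP fP; exists x => //; apply/AQ; by rewrite -Px.
rewrite (setIidr BA) esum_image; last by move=> x y _ _; apply: inj_psi.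
rewrite esum_fset; [|exact: finite_finset|by move=> *; rewrite f0].
rewrite -sumEFin -(@bigfs _ _ _ _ (index_enum F)) ?index_enum_uniq//.
  by apply: eq_bigr => x _; rewrite fg.
by move=> i _; rewrite mem_index_enum.
Qed.

(** * Displacements along paths of a shift schedule *)

Section Displacement.
Variables (N : nat) (s : seq 'Z_N).

Definition shift_at (t : int) : 'Z_N := nth 0 s `|(t %% (size s)%:Z)%Z|%N.

Fixpoint displacement (t : int) (ks : seq bool) : 'Z_N :=
  if ks is k :: ks' then (if k then shift_at t else 0) + displacement (t + 1) ks'
  else 0.

Lemma displacement_cat t k1 k2 :
  displacement t (k1 ++ k2) = displacement t k1 + displacement (t + (size k1)%:Z) k2.
Proof.
elim: k1 t => [|k k1 IH] t /=; first by rewrite add0r addr0.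
by rewrite IH addrA -[t + 1 + _]addrA -PoszD add1n.
Qed.

Lemma displacement_nseq t n : displacement t (nseq n false) = 0.
Proof. by elim: n t => [|n IH] t //=; rewrite IH addr0. Qed.

Lemma displacement_sum t ks :
  displacement t ks = \sum_(i < size ks) if nth false ks i then shift_at (t + i%:Z) else 0.
Proof.
elim: ks t => [|k ks IH] t /=; first by rewrite big_ord0.
rewrite big_ord_recl /= addr0 IH; congr (_ + _); apply: eq_bigr => i _.
by rewrite /bump /= PoszD addrA.
Qed.

Hypothesis s_gt0 : (0 < size s)%N.

Lemma sched_perm_shift t i : sched_perm (shift_schedule s) t i = i + shift_at t.
Proof.
rewrite /sched_perm /shift_schedule size_map (nth_map 0) ?permE //.
have s0 : (size s)%:Z != 0 by lia.
have : (t %% (size s)%:Z)%Z < (size s)%:Z by apply: ltz_pmod; lia.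
have := modz_ge0 t s0; case: (t %% _)%Z => //= n _.
Qed.

Lemma shift_atDM t q : shift_at (t + q * (size s)%:Z) = shift_at t.
Proof. by rewrite /shift_at addrC modzMDl. Qed.

Lemma path_end_shift a t ks :
  path_end (shift_schedule s) ((a, t), ks) =
  (a + displacement t ks, t + (size ks)%:Z).
Proof.
rewrite /path_end /path_edges /=.
elim: ks a t => [|k ks IH] a t /=; first by rewrite !addr0.
have -> : (if k then sched_perm (shift_schedule s) t a else a) =
          a + (if k then shift_at t else 0).
  by case: k; rewrite ?addr0 ?sched_perm_shift.
by rewrite IH addrA -[t + 1 + _]addrA -PoszD add1n.
Qed.

Lemma walk_time a t ks e : e \in walk (shift_schedule s) (a, t) ks ->
  exists2 p, (p < size ks)%N & (e.2.2 = t + p%:Z /\ e.1 = nth false ks p).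
Proof.
elim: ks a t => [|k ks IH] a t //=; rewrite inE => /orP[/eqP->|/IH[p pk [-> ->]]].
  by exists 0%N; rewrite //= addr0.
by exists p.+1; rewrite //= intS addrA.
Qed.

(** Only position [p] of the walk is at time [t + p], and the node there is the start moved by the
    displacement of the first [p] steps. *)
Lemma mem_walk a t ks i p :
  ((true, (i, t + p%:Z)) \in walk (shift_schedule s) (a, t) ks) =
  nth false ks p && (i == a + displacement t (take p ks)).
Proof.
elim: ks a t p => [|k ks IH] a t p; first by rewrite nth_nil.
rewrite /= inE; case: p => [|p] /=.
  rewrite !addr0 [X in _ || X](_ : _ = false).
    by rewrite orbF !xpair_eqE eqxx andbT; case: k.
  by apply/negP => /walk_time[p _ [/=]]; lia.
have -> : t + p.+1%:Z = t + 1 + p%:Z by rewrite intS addrA.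
rewrite IH !xpair_eqE [_ == t](_ : _ = false) ?andbF /=; last by apply/eqP; lia.
have -> : (if k then sched_perm (shift_schedule s) t a else a) =
          a + (if k then shift_at t else 0).
  by case: k; rewrite ?addr0 ?sched_perm_shift.
by rewrite addrA.
Qed.

End Displacement.

(** * Valiant load balancing over two consecutive windows *)

Section Routing.
Variables (R : realType) (N : nat) (s : seq 'Z_N) (L M : nat).
Hypothesis L_gt0 : (0 < L)%N.
Variables (w : int -> seq bool -> R) (lam : R).
Local Notation V := 'Z_N.
Local Notation n := (#|V|%:R : R).
Local Notation tup := (L.-tuple bool).
Let sched := shift_schedule s.

(** Time is cut into windows of length [L]. A path waits for the first window starting strictly
    after [t], even if [t] itself starts one, so the wait [padding t] lies between 1 and [L]. *)
Definition window (t : int) : int := (t %/ L%:Z)%Z + 1.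
Definition padding (t : int) : nat := (L - `|(t %% L%:Z)%Z|)%N.

Lemma window_block v (l : 'I_L) : window (v * L%:Z + l%:Z) = v + 1.
Proof.
rewrite /window divzMDl; last by lia.
by rewrite divz_small ?addr0 //; have := ltn_ord l; lia.
Qed.

Lemma padding_block v (l : 'I_L) : padding (v * L%:Z + l%:Z) = (L - l)%N.
Proof.
rewrite /padding modzMDl modz_small //; have := ltn_ord l; lia.
Qed.

Lemma blockP t : exists v (l : 'I_L), t = v * L%:Z + l%:Z.
Proof.
have L0 : L%:Z != 0 by lia.
have lt : (`|(t %% L%:Z)%Z| < L)%N.
  have : (t %% L%:Z)%Z < L%:Z by apply: ltz_pmod; lia.
  by have := modz_ge0 t L0; case: (t %% _)%Z => //= ? _.
exists (t %/ L%:Z)%Z, (Ordinal lt) => /=.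
by rewrite abszE ger0_norm ?modz_ge0 // -divz_eq.
Qed.

(* The flow from (a, t) to b is [n * sum of w b1 * w b2] over the pairs with total
   displacement b - a; as the displacements of b1 and b2 are uniform, this is 1 and
   the node reached after the first window is uniform. *)
Definition protocol (P : dpath V) : \bar R :=
  let: ((a, t), ks) := P in
  let ks' := drop (padding t) ks in
  if (size ks == padding t + (L + L))%N &&
     (take (padding t) ks == nseq (padding t) false) then
    (n * w (window t) (take L ks') * w (window t + 1) (drop L ks'))%:E
  else 0%E.

Definition route (v : int) (l : nat) (a : V) (b1 b2 : tup) : dpath V :=
  ((a, v * L%:Z + l%:Z), nseq (L - l) false ++ b1 ++ b2).

Lemma protocol_route v (l : 'I_L) a b1 b2 :
  protocol (route v l a b1 b2) = (n * w (v + 1) b1 * w (v + 2) b2)%:E.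
Proof.
rewrite /protocol /route padding_block window_block.
rewrite !size_cat !size_tuple eqxx /=.
rewrite take_size_cat ?size_nseq // eqxx drop_size_cat ?size_nseq //.
rewrite take_size_cat ?size_tuple // drop_size_cat ?size_tuple //.
by rewrite -addrA.
Qed.

Lemma protocol_supp P : protocol P != 0%E ->
  exists v (l : 'I_L) a b1 b2, P = route v l a b1 b2.
Proof.
case: P => -[a t] ks; rewrite /protocol; have [v [l ->]] := blockP t.
rewrite padding_block.
case: ifP; rewrite ?eqxx //= => /andP[/eqP sz /eqP tk] _.
pose ks' := drop (L - l) ks.
have s1 : size (take L ks') == L by rewrite size_takel // size_drop sz; lia.
have s2 : size (drop L ks') == L by rewrite !size_drop sz; apply/eqP; lia.
exists v, l, a, (Tuple s1), (Tuple s2); rewrite /route /=; congr pair.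
by rewrite -[LHS](cat_take_drop (L - l)) tk cat_take_drop.
Qed.

Lemma displacement_route v (l : 'I_L) (b1 b2 : tup) :
  displacement s (v * L%:Z + l%:Z) (nseq (L - l) false ++ b1 ++ b2) =
  displacement s ((v + 1) * L%:Z) b1 + displacement s ((v + 2) * L%:Z) b2.
Proof.
rewrite !displacement_cat displacement_nseq add0r size_nseq size_tuple.
have := ltn_ord l => lL.
have -> : v * L%:Z + l%:Z + (L - l)%N%:Z = (v + 1) * L%:Z by nia.
by congr (_ + displacement _ _ _); nia.
Qed.

Lemma route_inj v (l : 'I_L) a :
  injective (fun b : tup * tup => route v l a b.1 b.2).
Proof.
move=> [b1 b2] [c1 c2] [] /eqP; rewrite eqseq_cat // => /andP[_].
rewrite eqseq_cat ?size_tuple // => /andP[/eqP e1 /eqP e2].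
by congr pair; apply: val_inj.
Qed.

Lemma protocol_latency : (max_latency protocol <= (3 * L)%:R%:E)%E.
Proof.
apply: ge_ereal_sup => _ [P /= P0 <-].
have /protocol_supp[v [l [a [b1 [b2 ->]]]]] : protocol P != 0%E by rewrite gt_eqF.
rewrite lee_fin ler_nat /latency /= !size_cat !size_tuple ?size_nseq; lia.
Qed.

Hypothesis w_ge0 : forall u b, 0 <= w u b.

Lemma protocol_ge0 P : (0 <= protocol P)%E.
Proof.
case: P => -[a t] ks; rewrite /protocol; case: ifP => // _.
by rewrite lee_fin !mulr_ge0.
Qed.

Hypotheses (M_gt0 : (0 < M)%N) (sizes : size s = (M * L)%N).
Hypothesis w_periodic : forall u b, w (u + M%:Z) b = w u b.
Let s_gt0 : (0 < size s)%N. Proof. by rewrite sizes muln_gt0 M_gt0. Qed.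

Lemma protocol_periodic : periodic_flow (size s)%:Z protocol.
Proof.
have pT t : padding (t + (size s)%:Z) = padding t.
  by rewrite /padding sizes PoszM addrC modzMDl.
have wT t : window (t + (size s)%:Z) = window t + M%:Z.
  rewrite /window sizes PoszM (addrC t) divzMDl; last by lia.
  by rewrite -addrA addrC.
move=> [[a t] ks]; rewrite /delay /protocol /= pT wT.
by rewrite -(addrA _ M%:Z) (addrC M%:Z) addrA !w_periodic.
Qed.

Hypothesis w_unif : forall u x,
  \sum_(b : tup | displacement s (u * L%:Z) b == x) w u b = n^-1.

(** Grouping the patterns by displacement: each class has total weight [1 / n], so weighting by
    [n * w u] gives an unweighted sum over nodes. *)
Lemma sum_unif u (G : V -> R) :
  \sum_(b : tup) n * w u b * G (displacement s (u * L%:Z) b) = \sum_x G x.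
Proof.
rewrite (partition_big (fun b : tup => displacement s (u * L%:Z) b) predT) //=.
apply: eq_bigr => x _.
under eq_bigr => b /eqP-> do [].
rewrite -mulr_suml -mulr_sumr w_unif mulfV ?mul1r // pnatr_eq0 -lt0n.
by apply/card_gt0P; exists 0.
Qed.

Lemma protocol_oblivious : oblivious_routing sched protocol.
Proof.
split; [exact: protocol_ge0 | | move=> a b t].
  by rewrite /sched /shift_schedule size_map; exact: protocol_periodic.
have [v [l ->]] := blockP t.
pose Q (x : tup * tup) := a + (displacement s ((v + 1) * L%:Z) x.1 +
  displacement s ((v + 2) * L%:Z) x.2) == b.
pose g (x : tup * tup) := n * w (v + 1) x.1 * w (v + 2) x.2.
rewrite (@esum_inj_fin _ _ _ (fun x : tup * tup => route v l a x.1 x.2) _ _ g Q).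
- rewrite big_mkcond /= -(pair_bigA _ (fun b1 b2 => if Q (b1, b2) then g (b1, b2) else 0)) /=.
  (* Once [b1] is chosen, the displacement of [b2] is prescribed, and patterns with that
     displacement have total weight [1 / n]. *)
  rewrite (_ : \sum_i _ = \sum_(b1 : tup) n * w (v + 1) b1 * n^-1).
    by rewrite (sum_unif _ (fun=> n^-1)) sumr_const -[n^-1 *+ _]mulr_natl mulfV ?pnatr_eq0 // -lt0n; apply/card_gt0P; exists 0.
  apply: eq_bigr => b1 _; rewrite -big_mkcond /g /= -mulr_sumr; congr (_ * _).
  rewrite -(w_unif (v + 2) (b - a - displacement s ((v + 1) * L%:Z) b1)).
  apply: eq_bigl => b2; rewrite /Q /= -subr_eq0 -[RHS]subr_eq0; congr (_ == 0).
  by ring.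
- exact: route_inj.
- exact: protocol_ge0.
- by move=> x; rewrite protocol_route.
- move=> x; rewrite /Q /route /= path_end_shift // displacement_route; split.
    by case=> _ /= -> _.
  move=> /eqP e; split => //=; rewrite ltrDl size_cat size_cat !size_tuple ?size_nseq.
  by have := ltn_ord l; lia.
- move=> P [eP _ _] /protocol_supp[v' [l' [a' [b1 [b2 defP]]]]].
  move: eP; rewrite defP /path_start /route /= => -[-> /(congr1 (fun t => (window t, padding t)))].
  rewrite !window_block !padding_block => -[/addIr -> ll].
  have -> : l' = l by apply: val_inj => /=; have := ltn_ord l; have := ltn_ord l'; lia.
  by exists (b1, b2).
Qed.

Hypothesis w_load : forall u (p : 'I_L), \sum_(b : tup | tnth b p) w u b <= lam.

(** An edge in window [v] is crossed either in the first window of a path starting in block [v - 1]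
    or in the second window of a path starting in block [v - 2]. Each of these [2 * L] start times
    contributes at most [r * lam]: the crossing patterns have weight at most [lam], and the endpoint
    they leave free is uniform, which produces a row or column sum of [D]. *)
Lemma protocol_throughput (r : R) :
  r * (2 * L%:R * lam) <= 1 -> guarantees_throughput sched protocol r.
Proof.
move=> rle D D0 Drow Dcol [i t0].
have r0 : 0 <= r by apply: le_trans (Drow 0 0); apply: sumr_ge0.
have [v [p ->]] := blockP t0.
rewrite /edge_flow /induced_flow.
pose F : finType := ((bool * 'I_L) * (V * (tup * tup)))%type.
(* [c] tells whether the edge is crossed in the second window; [blk c] is the block of the start
   time. *)
pose blk (c : bool) : int := v - 1 - (c : nat)%:Z.
pose psi (x : F) := let: ((c, l), (a, (b1, b2))) := x in route (blk c) l a b1 b2.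
pose dest (c : bool) a b1 b2 := a +
  (displacement s ((blk c + 1) * L%:Z) b1 + displacement s ((blk c + 2) * L%:Z) b2).
pose g (x : F) := let: ((c, l), (a, (b1, b2))) := x in
  D a (dest c a b1 b2) (blk c * L%:Z + l%:Z)
  * (n * w (blk c + 1) b1 * w (blk c + 2) b2).
pose prefix (b : tup) := displacement s (v * L%:Z) (take p b).
pose Q (x : F) := let: ((c, l), (a, (b1, b2))) := x in
  if c then tnth b2 p && (a == i - prefix b2 - displacement s ((blk c + 1) * L%:Z) b1)
  else tnth b1 p && (a == i - prefix b1).
have loc (c : bool) (l : 'I_L) :
  v * L%:Z + p%:Z = blk c * L%:Z + l%:Z + (L - l + (c * L + p))%N%:Z.
  by rewrite /blk; have := ltn_ord l; case: c; nia.
rewrite (@esum_inj_fin _ _ F psi _ _ g Q).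
- rewrite lee_fin.
  pose h x := if Q x then g x else 0.
  rewrite big_mkcond -[X in X <= _]/(\sum_x h x).
  rewrite (_ : \sum_x h x = \sum_cl \sum_y h (cl, y)); last first.
    by rewrite pair_bigA /=; apply: eq_bigr => -[].
  apply: le_trans rle.
  rewrite (_ : r * (2 * L%:R * lam) = \sum_(cl : bool * 'I_L) r * lam); last first.
    rewrite sumr_const card_prod card_bool card_ord -[RHS]mulr_natl natrM.
    by rewrite mulrCA.
  apply: ler_sum => -[c l] _.
  rewrite (_ : \sum_y h (c, l, y) =
    \sum_(a : V) \sum_(b1 : tup) \sum_(b2 : tup) h ((c, l), (a, (b1, b2)))); last first.
    under [RHS]eq_bigr do rewrite pair_bigA /=.
    by rewrite pair_bigA /=; apply: eq_bigr => -[a [b1 b2]].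
  have fin (f : tup -> V) u (G : tup -> V -> R) : u = v ->
      (forall b, \sum_x G b x <= r) ->
      \sum_(b | tnth b p) w u b * (\sum_x G b x) <= r * lam.
    move=> -> Gr; apply: (@le_trans _ _ (\sum_(b : tup | tnth b p) w v b * r)).
      by apply: ler_sum => b _; rewrite ler_wpM2l.
    by rewrite -mulr_suml mulrC ler_wpM2l.
  case: c.
  (* Second window: [b2] fixes the intermediate node [i - prefix b2] and the destination [y b2],
     while [b1] makes the source uniform; a column sum appears. *)
  + rewrite exchange_big /=; under eq_bigr do rewrite exchange_big /=.
    rewrite exchange_big /=.
    pose y (b2 : tup) := i - prefix b2 + displacement s ((blk true + 2) * L%:Z) b2.
    pose T := blk true * L%:Z + l%:Z.
    apply: le_trans (fin (fun=> 0) (blk true + 2) (fun b2 x => D (i - prefix b2 - x) (y b2) T) _ _).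
    * rewrite [leRHS]big_mkcond /=; apply: ler_sum => b2 _.
      case: ifP => b2p; last first.
        rewrite big1 // => b1 _; rewrite big1 // => a _; by rewrite /h /Q b2p.
      rewrite -(sum_unif (blk true + 1)) mulr_sumr; apply: ler_sum => b1 _.
      rewrite (bigD1 (i - prefix b2 - displacement s ((blk true + 1) * L%:Z) b1)) //=.
      rewrite big1 ?addr0; last by move=> a ane; rewrite /h /Q (negPf ane) andbF.
      rewrite /h /Q b2p eqxx /= /g /dest /y.
      rewrite [_ + (_ + _)](_ : _ = i - prefix b2 + displacement s ((blk true + 2) * L%:Z) b2); last by ring.
      by rewrite -/T le_eqVlt; apply/orP; left; apply/eqP; ring.
    * by rewrite /blk; lia.
    * move=> b2; rewrite (reindex_inj (inv_inj (subKr (i - prefix b2)))) /=.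
      by under eq_bigr do rewrite subKr; exact: Dcol.
  (* First window: [b1] fixes the source [a0 b1], while [b2] makes the destination uniform; a row
     sum appears. *)
  + rewrite exchange_big /=; under eq_bigr do rewrite exchange_big /=.
    pose T := blk false * L%:Z + l%:Z.
    pose a0 b1 := i - prefix b1.
    pose e0 (b1 : tup) := a0 b1 + displacement s ((blk false + 1) * L%:Z) b1.
    apply: le_trans (fin (fun=> 0) (blk false + 1) (fun b1 x => D (a0 b1) (e0 b1 + x) T) _ _).
    * rewrite [leRHS]big_mkcond /=; apply: ler_sum => b1 _.
      case: ifP => b1p; last first.
        rewrite big1 // => b2 _; rewrite big1 // => a _; by rewrite /h /Q b1p.
      rewrite -(sum_unif (blk false + 2)) mulr_sumr; apply: ler_sum => b2 _.
      rewrite (bigD1 (a0 b1)) //= big1 ?addr0; last first.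
        by move=> a ane; rewrite /h /Q (negPf ane) andbF.
      rewrite /h /Q b1p eqxx /= /g.
      have -> : dest false (a0 b1) b1 b2 =
                e0 b1 + displacement s ((blk false + 2) * L%:Z) b2.
        by rewrite /dest /e0 addrA.
      by rewrite -/T le_eqVlt; apply/orP; left; apply/eqP; ring.
    * by rewrite /blk; lia.
    * move=> b1; rewrite -(reindex_inj (addrI (e0 b1)) (P := predT) (F := fun x => D (a0 b1) x T)) /=.
      exact: Drow.
- move=> [[c l] [a [b1 b2]]] [[c' l'] [a' [b1' b2']]] /= e.
  move: (congr1 (fun P : dpath V => (window P.1.2, padding P.1.2)) e) => /=.
  rewrite !window_block !padding_block => -[/addIr ec el].
  have cc : c = c' by move: ec; rewrite /blk; case: c {e}; case: c' => //=; lia.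
  have ll : l = l' by apply: val_inj => /=; have := ltn_ord l; have := ltn_ord l'; lia.
  subst c' l'; have aa := congr1 (fun P : dpath V => P.1.1) e; rewrite /= in aa; subst a'.
  by have := @route_inj (blk c) l a (b1, b2) (b1', b2') e => -[-> ->].
- move=> P; rewrite mule_ge0 ?protocol_ge0 // lee_fin; exact: D0.
- move=> [[c l] [a [b1 b2]]]; rewrite /psi protocol_route /route /=.
  by rewrite path_end_shift // displacement_route.
- move=> [[c l] [a [b1 b2]]] /=; rewrite /path_edges /= (loc c l) mem_walk //.
  have := ltn_ord l; have := ltn_ord p => pL lL.
  have -> : nth false (nseq (L - l) false ++ b1 ++ b2) (L - l + (c * L + p)) =
            if c then tnth b2 p else tnth b1 p.
    rewrite nth_cat size_nseq ltnNge leq_addr /= addKn nth_cat size_tuple.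
    case: c; rewrite ?mul1n ?mul0n ?add0n ?pL ?(tnth_nth false) //.
    by rewrite ltnNge leq_addr /= addKn.
  have -> : displacement s (blk c * L%:Z + l%:Z)
              (take (L - l + (c * L + p)) (nseq (L - l) false ++ b1 ++ b2)) =
            if c then displacement s ((blk c + 1) * L%:Z) b1 + prefix b2 else prefix b1.
    rewrite take_cat size_nseq ltnNge leq_addr /= addKn displacement_cat.
    rewrite displacement_nseq add0r size_nseq take_cat size_tuple /prefix.
    case: c; rewrite ?mul1n ?mul0n ?add0n ?pL.
      rewrite ltnNge leq_addr /= addKn displacement_cat size_tuple.
      by congr (displacement _ _ _ + displacement _ _ _); rewrite /blk; nia.
    by congr (displacement _ _ _); rewrite /blk; nia.
  have eqE (x y z : V) : (x == y + z) = (y == x - z).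
    by rewrite [RHS]eq_sym subr_eq.
  by case: c; rewrite [i == _]eqE ?opprD ?addrA // (addrAC i).
- move=> P ep fP; have /protocol_supp [v' [l [a [b1 [b2 defP]]]]] : protocol P != 0%E.
    by apply: contraNneq fP => ->; rewrite mule0.
  move: ep; rewrite defP /path_edges /route /=.
  set ks := _ ++ _ => e.
  have /walk_time [q qlt [/= te nq]] := e; rewrite // in te.
  have pq : (L - l <= q)%N.
    rewrite leqNgt; apply/negP => ql; move: nq.
    by rewrite /ks nth_cat size_nseq ql nth_nseq ql.
  have qlt2 : (q < L - l + (L + L))%N.
    by move: qlt; rewrite /ks !size_cat size_nseq !size_tuple.
  (* The edge lies among the [2 * L] steps after the padding, so [v'] is [v - 1] or [v - 2]. *)
  have [c vc] : exists c, v' = blk c.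
    have := ltn_ord p; have := ltn_ord l => lL pL.
    exists (v' != v - 1); rewrite /blk; case: eqP => [->|ne] /=; first by rewrite subr0.
    suff : v' < v /\ v - 3 < v' by lia.
    by split; nia.
  by exists ((c, l), (a, (b1, b2))); rewrite /psi -vc.
Qed.

End Routing.

Local Close Scope classical_set_scope.

(** * Exactly uniform weights from nearly uniform samples *)

Section SampledRouting.
Variables (R : realType) (N : nat) (s : seq 'Z_N) (L M : nat).
Hypotheses (L_gt0 : (0 < L)%N) (M_gt0 : (0 < M)%N) (sizes : size s = (M * L)%N).
Variables (Om : finType) (S : Om -> {set 'I_L}) (kap lam : R).
Local Notation V := 'Z_N.

Definition sample_shift (u : int) (o : Om) : V :=
  \sum_(p in S o) shift_at s (u * L%:Z + (p : nat)%:Z).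

Hypotheses (Om_gt0 : (0 < #|Om|)%N) (kap_gt0 : 0 < kap)
  (cover : forall u x,
     kap * #|Om|%:R <= #|V|%:R * #|[set o | sample_shift u o == x]|%:R)
  (load : forall p, #|[set o | p \in S o]|%:R <= lam * #|Om|%:R).

(** Each sample gets a weight inversely proportional to the number of samples with the same total
    shift, which makes the shift exactly uniform. By [cover] no weight exceeds [1 / (kap * #|Om|)],
    so the load [lam] grows at most to [lam / kap]. *)
Lemma sampled_routing : exists f : dpath V -> \bar R,
  [/\ oblivious_routing (shift_schedule s) f,
      forall r, r * (2 * L%:R * (lam / kap)) <= 1 ->
        guarantees_throughput (shift_schedule s) f r &
      (max_latency f <= (3 * L)%:R%:E)%E].
Proof.
pose ind (o : Om) : L.-tuple bool := [tuple p \in S o | p < L].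
pose cnt u x : R := #|[set o | sample_shift u o == x]|%:R.
(* Different samples may select the same set of times; their weights are added. *)
pose w u (b : seq bool) : R :=
  \sum_(o | val (ind o) == b) (#|V|%:R * cnt u (sample_shift u o))^-1.
have Om0 : 0 < #|Om|%:R :> R by rewrite ltr0n.
have ind_shift u o : displacement s (u * L%:Z) (ind o) = sample_shift u o.
  rewrite displacement_sum size_tuple /sample_shift [RHS]big_mkcond /=.
  by apply: eq_bigr => p _; rewrite -(tnth_nth false (ind o)) tnth_mktuple.
have cnt_gt0 u x : 0 < #|V|%:R * cnt u x.
  by apply: lt_le_trans (cover u x); rewrite mulr_gt0.
have cnt0 u x : 0 < cnt u x.
  by rewrite lt_neqAle ler0n andbT eq_sym; apply: contraTneq (cnt_gt0 u x) => ->; rewrite mulr0 ltxx.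
have w0 u b : 0 <= w u b.
  by apply: sumr_ge0 => o _; rewrite invr_ge0 ltW.
have wP u b : w (u + M%:Z) b = w u b.
  have e : sample_shift (u + M%:Z) = sample_shift u.
    apply/funext => o; apply: eq_bigr => p _; rewrite -(shift_atDM s (u * L%:Z + (p : nat)%:Z) 1).
    by congr shift_at; rewrite sizes PoszM; ring.
  by rewrite /w /cnt e.
have sumw u (Q : pred (L.-tuple bool)) :
    \sum_(b : L.-tuple bool | Q b) w u b =
    \sum_(o | Q (ind o)) (#|V|%:R * cnt u (sample_shift u o))^-1.
  rewrite [RHS](partition_big ind Q) //=; apply: eq_bigr => b Qb.
  apply: eq_bigl => o; rewrite -val_eqE /=.
  by case: eqP => [e|]; rewrite ?andbF // andbT (_ : ind o = b) ?Qb //; apply: val_inj.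
have wU u x : \sum_(b : L.-tuple bool | displacement s (u * L%:Z) b == x) w u b
    = #|V|%:R^-1.
  rewrite sumw; under eq_bigl do rewrite ind_shift.
  under eq_bigr => o /eqP-> do rewrite invfM.
  rewrite -mulr_sumr (eq_bigl (fun o => o \in [set o | sample_shift u o == x])); last first.
    by move=> o; rewrite inE.
  by rewrite sumr_const -[X in _ * X]mulr_natr mulVf ?mulr1 // gt_eqF.
have wL u p : \sum_(b : L.-tuple bool | tnth b p) w u b <= lam / kap.
  rewrite sumw; under eq_bigl do rewrite tnth_mktuple.
  apply: (@le_trans _ _ (\sum_(o | p \in S o) (kap * #|Om|%:R)^-1)).
    by apply: ler_sum => o _; rewrite lef_pV2 ?posrE ?cnt_gt0 ?mulr_gt0 //; exact: cover.
  rewrite (eq_bigl (fun o => o \in [set o | p \in S o])); last by move=> o; rewrite inE.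
  rewrite sumr_const -[leLHS]mulr_natr.
  rewrite mulrC ler_pdivrMr ?mulr_gt0 // mulrA divfK ?gt_eqF //.
exists (protocol L w); split.
- exact: (protocol_oblivious L_gt0 w0 M_gt0 sizes wP wU).
- by move=> r; exact: (protocol_throughput L_gt0 w0 M_gt0 sizes wU wL).
- exact: protocol_latency.
Qed.

End SampledRouting.

(** * Sums of rotated digits *)

Local Close Scope ring_scope.

Definition digit (Q k v : nat) : nat := (v %/ Q ^ k) %% Q.

Definition number (Q m : nat) (d : nat -> nat) : nat := \sum_(k < m) d k * Q ^ k.

Section Digits.
Variables (Q : nat) (d : nat -> nat).
Hypothesis dQ : forall k, d k < Q.

Let Q_gt0 : 0 < Q. Proof. exact: leq_trans (dQ 0). Qed.

Lemma number_lt m : number Q m d < Q ^ m.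
Proof.
elim: m => [|m IH]; first by rewrite /number big_ord0.
rewrite /number big_ord_recr /= -/(number Q m d) expnS.
apply: leq_trans (_ : (d m).+1 * Q ^ m <= _); first by rewrite mulSn ltn_add2r.
by rewrite leq_mul2r dQ orbT.
Qed.

Lemma digit_number m u k : k < m -> digit Q k (number Q m d + Q ^ m * u) = d k.
Proof.
move=> km.
(* The digits below [k] form a number less than [Q ^ k]; [r] collects everything above place [k]. *)
have [r ->] : exists r, number Q m d + Q ^ m * u = (d k + r * Q) * Q ^ k + number Q k d.
  elim: m u km => // m IH u; rewrite ltnS leq_eqVlt => /orP[/eqP<-|km].
    exists u; rewrite /number big_ord_recr /= -/(number Q k d) expnS; ring.
  have [r rE] := IH (d m + Q * u) km; exists r; rewrite -rE.
  rewrite /number big_ord_recr /= -/(number Q m d) expnS; ring.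
rewrite /digit divnMDl ?expn_gt0 ?Q_gt0 // divn_small ?number_lt // addn0.
by rewrite addnC modnMDl modn_small.
Qed.

Lemma digit_number_high m u k : digit Q (m + k) (number Q m d + Q ^ m * u) = digit Q k u.
Proof.
rewrite /digit expnD divnMA addnC mulnC divnMDl ?expn_gt0 ?Q_gt0 //.
by rewrite (divn_small (number_lt m)) addn0.
Qed.

End Digits.

Lemma number_inj Q m (d d' : nat -> nat) :
  (forall k, d k < Q) -> (forall k, d' k < Q) -> number Q m d = number Q m d' ->
  forall k, k < m -> d k = d' k.
Proof.
move=> dQ dQ' e k km.
by rewrite -(digit_number dQ 0 km) e digit_number.
Qed.

Definition extend Q m (a : 'I_m -> 'I_Q) (k : nat) : nat :=
  if insub k is Some r then a r else 0.

Lemma extendE Q m (a : 'I_m -> 'I_Q) (r : 'I_m) : extend a r = a r.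
Proof. by rewrite /extend valK. Qed.

Lemma extend_lt Q m (a : 'I_m -> 'I_Q) k : 0 < Q -> extend a k < Q.
Proof. by rewrite /extend; case: insubP. Qed.

(** * Equidistribution of digit sums modulo [N] *)

Section Covering.
Variables (N : nat) (Q R : nat) (I : finType).
Hypotheses (N_gt1 : 1 < N) (Q_gt0 : 0 < Q).
Variables (ex : I -> 'I_R) (sec : 'I_R -> I).
Hypothesis secK : cancel sec ex.
Local Notation A := {ffun 'I_R -> 'I_Q}.
Local Notation D := {ffun I -> 'I_Q}.

(** The numbers [z * N + c] with [z < M %/ N] are distinct representatives of [c] below [M]. *)
Lemma card_residue (c : 'Z_N) M : M %/ N <= #|[set y : 'I_M | (y%:R == c :> 'Z_N)%R]|.
Proof.
have cN : c < N by rewrite -[X in _ < X](Zp_cast N_gt1) ltn_ord.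
have zM (z : 'I_(M %/ N)) : z * N + c < M.
  have := ltn_ord z => zl; apply: (@leq_trans (z.+1 * N)); first by rewrite mulSn addnC ltn_add2r.
  by apply: leq_trans (leq_trunc_div M N); rewrite leq_mul2r zl orbT.
rewrite -[leqLHS]card_ord -(@card_imset _ _ (fun z => Ordinal (zM z))); last first.
  move=> z z' [] /eqP; rewrite eqn_add2r eqn_pmul2r; last exact: ltnW.
  by move/eqP/val_inj.
apply: subset_leq_card; apply/fintype.subsetP => _ /imsetP[z _ ->]; rewrite inE /=.
apply/eqP/val_inj; rewrite /= val_Zp_nat // modnMDl modn_small //.
Qed.

Lemma card_number (c : 'Z_N) :
  Q ^ R %/ N <= #|[set a : A | ((\sum_r a r * Q ^ r)%N%:R == c :> 'Z_N)%R]|.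
Proof.
have valQ (a : A) k : extend a k < Q by exact: extend_lt.
have numE (a : A) : \sum_r a r * Q ^ r = number Q R (extend a).
  by apply: eq_bigr => r _; rewrite extendE.
have num_lt (a : A) : \sum_r a r * Q ^ r < Q ^ R by rewrite numE number_lt.
pose f (a : A) : 'I_(Q ^ R) := Ordinal (num_lt a).
have f_inj : injective f.
  move=> a a' [] ; rewrite !numE => e; apply/ffunP => r; apply/val_inj.
  by rewrite /= -!extendE; apply: number_inj e _ _.
have [g fK gK] : bijective f.
  by apply: inj_card_bij => //; rewrite card_ffun !card_ord.
apply: leq_trans (card_residue c (Q ^ R)) _.
rewrite -(card_imset _ (can_inj gK)); apply: subset_leq_card.
apply/fintype.subsetP => _ /imsetP[y + ->]; rewrite !inE => /eqP<-; apply/eqP.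
by rewrite -[in RHS](gK y).
Qed.

(* [(a, e) |-> (e \o sec, patch a e)] is an involution, so the patched families
   are equidistributed although different pairs give the same family. *)
Definition patch (a : A) (e : D) : D :=
  [ffun i => if sec (ex i) == i then a (ex i) else e i].

(** Several digits may share a place, but [sec] selects one digit for every place. The selected
    digits form a uniform number below [Q ^ R], and the others only add a constant, so each residue
    gets nearly its share whatever they are. *)
Lemma card_covering (c : 'Z_N) :
  Q ^ #|I| * (Q ^ R %/ N) <=
  Q ^ R * #|[set d : D | ((\sum_i d i * Q ^ ex i)%N%:R == c :> 'Z_N)%R]|.
Proof.
pose good (d : D) := ((\sum_i d i * Q ^ ex i)%N%:R == c :> 'Z_N)%R.
have swapK : involutive (fun x : A * D => ([ffun r => x.2 (sec r)] : A, patch x.1 x.2)).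
  move=> [a e] /=; congr pair; apply/ffunP => i; rewrite !ffunE ?secK ?eqxx //.
  by case: eqP => // ->.
have -> : Q ^ R * #|[set d : D | good d]| = \sum_(x : A * D) good x.2.
  rewrite -(pair_bigA _ (fun (a : A) (d : D) => nat_of_bool (good d))) /=.
  rewrite sum_nat_const card_ffun !card_ord; congr (_ * _).
  by rewrite -sum1dep_card big_mkcond; apply: eq_bigr => d _; case: good.
(* After the swap, [e] fixes the digits off the section and [a] runs through those on it. *)
rewrite (reindex_inj (inv_inj swapK)) /= -(pair_bigA _ (fun a e => nat_of_bool (good (patch a e)))) /=.
rewrite exchange_big /=.
have -> : Q ^ #|I| * (Q ^ R %/ N) = \sum_(e : D) Q ^ R %/ N.
  by rewrite sum_nat_const card_ffun card_ord.
apply: leq_sum => e _.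
pose rest := \sum_(i | sec (ex i) != i) e i * Q ^ ex i.
apply: leq_trans (card_number (c - rest%:R)%R) _.
rewrite -sum1dep_card big_mkcond; apply: leq_sum => a _.
rewrite (_ : good _ = (((\sum_r a r * Q ^ r)%N%:R + rest%:R)%R == c)).
  by rewrite -subr_eq0 opprB addrA subr_eq0; case: eqP.
rewrite /good; congr (_ == c); rewrite -natrD; congr (_%:R)%R.
rewrite (bigID (fun i => sec (ex i) == i)) /=; congr addn.
  rewrite (reindex sec) /=; last first.
    by exists ex => i; rewrite ?inE ?secK // => /eqP.
  apply: eq_big => [r|r _]; first by rewrite secK eqxx.
  by rewrite ffunE secK eqxx.
by apply: eq_bigr => i /negPf ne; rewrite ffunE ne.
Qed.

End Covering.

(** * The rotation schedule and its windows *)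

Definition rotated (R Q rho v : nat) : nat :=
  \sum_(k < R) digit Q k v * Q ^ ((k + rho) %% R).

Definition shift_value (R Q l t : nat) : nat :=
  let v := t %/ R.+1 in let rho := t %% R.+1 in
  if rho < R then rotated R Q rho v else 2 ^ (v %% l).

(** [Q ^ R * l] counter values are a common period of the [R] low digits and of the powers of two,
    and the length is a multiple of both window lengths used below. *)
Definition rotation_schedule (N R Q l : nat) : seq 'Z_N :=
  [seq ((shift_value R Q l t)%:R)%R | t <- iota 0 (R.+1 * Q ^ R * l)].

Lemma size_rotation_schedule N R Q l :
  size (rotation_schedule N R Q l) = R.+1 * Q ^ R * l.
Proof. by rewrite size_map size_iota. Qed.

(** When only the low [m] digits vary, the high digits, fixed by [u], contribute a constant. *)
Lemma rotated_number R Q m rho u :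
  m <= R -> exists c, forall d, (forall k, d k < Q) ->
    rotated R Q rho (number Q m d + Q ^ m * u) =
    \sum_(k < m) d k * Q ^ ((k + rho) %% R) + c.
Proof.
move=> mR; exists (\sum_(0 <= k < R - m) digit Q k u * Q ^ ((m + k + rho) %% R)) => d dQ.
rewrite /rotated -(big_mkord xpredT (fun k => digit Q k _ * Q ^ ((k + rho) %% R))).
rewrite (big_cat_nat _ (n := m)) //=; congr addn.
  by rewrite big_mkord; apply: eq_bigr => k _; rewrite digit_number.
rewrite -{1}[m]add0n big_addn; apply: eq_bigr => k _.
by rewrite addnC digit_number_high.
Qed.

Lemma shift_at_block N R Q l L M (s := rotation_schedule N R Q l) (u : int) :
  size s = M * L -> 0 < M -> exists u' : nat, forall p, p < L ->
  shift_at s (u * Posz L + Posz p)%R = ((shift_value R Q l (u' * L + p))%:R)%R.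
Proof.
move=> sizes M_gt0; have M0 : (M%:Z != 0)%R by lia.
have [u' uE] : exists u' : nat, (u %% Posz M)%Z = u'.
  by exists (absz (u %% Posz M)%Z); have := modz_ge0 u M0; lia.
have u'M : u' < M.
  have : ((u %% Posz M)%Z < Posz M)%R by apply: ltz_pmod; lia.
  by rewrite uE.
exists u' => p pL.
have lt : u' * L + p < size s.
  rewrite sizes; apply: leq_trans (_ : u'.+1 * L <= _).
    by rewrite mulSn addnC ltn_add2r.
  by rewrite leq_mul2r u'M orbT.
have E : modz (u * Posz L + Posz p)%R (Posz (size s)) = Posz (u' * L + p).
  rewrite {1}(divz_eq u (Posz M)) uE.
  have -> : (((u %/ Posz M)%Z * Posz M + Posz u') * Posz L + Posz p =
             (u %/ Posz M)%Z * Posz (size s) + Posz (u' * L + p))%R.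
    by rewrite sizes !PoszM PoszD !PoszM; ring.
  by rewrite modzMDl modz_small //; lia.
move: lt; rewrite /s size_map size_iota => lt.
by rewrite /shift_at E absz_nat (nth_map 0) ?nth_iota // size_iota.
Qed.

Lemma shift_value_row R Q l v rho : rho < R.+1 ->
  shift_value R Q l (R.+1 * v + rho) =
  if rho < R then rotated R Q rho v else 2 ^ (v %% l).
Proof.
by move=> rR; rewrite /shift_value mulnC divnMDl // divn_small // addn0 modnMDl modn_small.
Qed.

Lemma split_slot (R v v' rho rho' : nat) : rho < R -> rho' < R ->
  R.+1 * v + rho = R.+1 * v' + rho' -> v = v' /\ rho = rho'.
Proof.
move=> r r' e.
have := congr1 (divn^~ R.+1) e; have := congr1 (modn^~ R.+1) e.
rewrite /= ![R.+1 * _]mulnC !modnMDl !divnMDl // !modn_small; try by lia.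
by rewrite !divn_small ?addn0 //; lia.
Qed.

(** * Samples with one slot in each of [h] rows *)

Section MainRows.
Variables (N R Q l w h : nat).
Hypotheses (Q_gt0 : 0 < Q) (R_gt0 : 0 < R) (w_le : w <= R).
Local Notation s := (rotation_schedule N R Q l).
Local Notation L := (R.+1 * Q ^ w).
Local Notation M := (Q ^ (R - w) * l).
Local Notation Om := ('I_R * {ffun 'I_h * 'I_w -> 'I_Q})%type.

Lemma size_schedule_blocks : size s = M * L.
Proof.
rewrite size_rotation_schedule (_ : Q ^ R = Q ^ (R - w) * Q ^ w); first by ring.
by rewrite -expnD subnK.
Qed.

(** The chosen rows are [w] apart: at [row j i] the low [w] digits occupy the places from
    [j + i * w] on, modulo [R], so [h] rows reach all places once [R <= h * w]. *)
Definition row (j : 'I_R) (i : nat) : nat := (j + i * w) %% R.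

Definition block_number (d : {ffun 'I_h * 'I_w -> 'I_Q}) (i : 'I_h) : nat :=
  number Q w (extend (fun k => d (i, k))).

Lemma row_lt j i : row j i < R. Proof. exact: ltn_pmod. Qed.

Lemma block_number_lt d i : block_number d i < Q ^ w.
Proof. by apply: number_lt => k; exact: extend_lt. Qed.

Lemma slot_lt (o : Om) i : R.+1 * block_number o.2 i + row o.1 i < L.
Proof.
apply: leq_trans (_ : R.+1 * (block_number o.2 i).+1 <= _).
  by rewrite mulnS addnC ltn_add2r ltnS ltnW // row_lt.
by rewrite leq_pmul2l // block_number_lt.
Qed.

Definition slot (o : Om) (i : 'I_h) : 'I_L := Ordinal (slot_lt o i).

Definition slots (o : Om) : {set 'I_L} := [set slot o i | i : 'I_h].

Hypotheses (w_gt0 : 0 < w) (hw_lt : h.-1 * w < R).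

(** As [h.-1 * w < R], the offsets [i * w] do not wrap around; hence the slots of a sample are
    distinct times. *)
Lemma row_inj j : {in gtn h &, injective (row j)}.
Proof.
move=> i i'; rewrite !unfold_in /= => ih ih' /eqP; rewrite eqn_modDl.
rewrite !modn_small; first by rewrite eqn_pmul2r // => /eqP.
  by apply: leq_ltn_trans hw_lt; rewrite leq_mul2r; lia.
by apply: leq_ltn_trans hw_lt; rewrite leq_mul2r; lia.
Qed.

Lemma slot_inj o : injective (slot o).
Proof.
move=> i i' [] /split_slot[]; rewrite ?row_lt // => _ /row_inj e; apply: val_inj.
by apply: e; rewrite unfold_in /=.
Qed.

Hypothesis hw_ge : R <= h * w.

Definition place (j : 'I_R) (x : 'I_h * 'I_w) : 'I_R :=
  Ordinal (ltn_pmod (x.2 + row j x.1) R_gt0).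

(** For the offset [e r] of the place [r] from [j], the quotient and remainder by [w] give the row
    and the digit. *)
Lemma place_onto j : exists sec, cancel sec (place j).
Proof.
pose e (r : 'I_R) := (r + (R - j)) %% R.
have eR r : e r < R by exact: ltn_pmod.
have e1 r : e r %/ w < h by rewrite ltn_divLR // (leq_trans (eR r)).
exists (fun r => (Ordinal (e1 r), Ordinal (ltn_pmod (e r) w_gt0))) => r.
apply: val_inj; rewrite /= /row modnDmr addnC -addnA -divn_eq /e modnDmr.
by rewrite addnCA subnKC ?modnDr ?modn_small // ltnW.
Qed.

Hypotheses (N_gt1 : 1 < N) (l_gt0 : 0 < l).
Let M_gt0 : 0 < M. Proof. by rewrite muln_gt0 expn_gt0 Q_gt0. Qed.

Lemma sample_shift_slots u j : exists c : nat, forall d,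
  (sample_shift s slots u (j, d) =
   ((\sum_x d x * Q ^ place j x)%N + c)%:R)%R.
Proof.
have [u' sE] := shift_at_block u size_schedule_blocks M_gt0.
have /choice [c cE] : forall i : 'I_h, exists c, forall a, (forall k, a k < Q) ->
    rotated R Q (row j i) (number Q w a + Q ^ w * u') =
    \sum_(k < w) a k * Q ^ ((k + row j i) %% R) + c.
  by move=> i; exact: rotated_number.
exists (\sum_i c i) => d.
rewrite /sample_shift /slots big_imset /=; last by move=> ? ? _ _; apply: slot_inj.
have -> : \sum_x d x * Q ^ place j x = \sum_i \sum_k d (i, k) * Q ^ place j (i, k).
  by rewrite pair_bigA /=; apply: eq_bigr => -[].
rewrite -big_split /= natr_sum; apply: eq_bigr => i _.
rewrite sE; last exact: (slot_lt (j, d) i).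
have -> : u' * L + (R.+1 * block_number d i + row j i) =
          R.+1 * (block_number d i + Q ^ w * u') + row j i by ring.
rewrite shift_value_row; last by rewrite ltnW // ltnS row_lt.
rewrite row_lt cE; last by move=> k; exact: extend_lt.
by congr ((_ + _)%:R)%R; apply: eq_bigr => k _; rewrite extendE.
Qed.

Lemma card_samples : #|{: Om}| = R * Q ^ (h * w).
Proof. by rewrite card_prod card_ffun card_prod !card_ord. Qed.

Lemma cover_slots u x :
  #|{: Om}| * (Q ^ R %/ N) <= Q ^ R * #|[set o : Om | sample_shift s slots u o == x]|.
Proof.
rewrite -[in leqRHS]sum1dep_card big_mkcond /=.
rewrite (_ : \sum_o _ =
  \sum_j \sum_d if sample_shift s slots u (j, d) == x then 1 else 0); last first.
  by rewrite pair_bigA /=; apply: eq_bigr => -[].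
rewrite big_distrr /= card_samples -mulnA.
rewrite -[in leqLHS](card_ord R) -sum_nat_const; apply: leq_sum => j _.
have [c cE] := sample_shift_slots u j; have [sec secK] := place_onto j.
have := card_covering N_gt1 Q_gt0 secK (x - c%:R)%R.
rewrite card_prod !card_ord => /leq_trans; apply; rewrite leq_mul2l; apply/orP; right.
rewrite -sum1dep_card big_mkcond /=; apply: leq_sum => d _.
by rewrite cE natrD -subr_eq0 opprB addrA subr_eq0.
Qed.

(** For fixed [i] the slot is uniform over [R * Q ^ w] times: it determines [j] and the digits of
    block [i], so overwriting these by arbitrary values, as [upd] does, is injective on the samples
    with slot [p]. The sum over [i] gives the factor [h]. *)
Lemma load_slots p :
  #|[set o : Om | p \in slots o]| * (R * Q ^ w) <= h * #|{: Om}|.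
Proof.
apply: (@leq_trans (\sum_(i < h) #|[set o : Om | slot o i == p]| * (R * Q ^ w))).
  rewrite -big_distrl /= leq_mul2r; apply/orP; right.
  rewrite -sum1dep_card.
  under [leqRHS]eq_bigr do rewrite -sum1dep_card big_mkcond.
  rewrite exchange_big /= big_mkcond; apply: leq_sum => o _.
  by case: imsetP => // -[i _ ->]; rewrite (bigD1 i) //= eqxx.
apply: leq_trans (_ : \sum_(i < h) #|{: Om}| <= _); last by rewrite sum_nat_const card_ord.
apply: leq_sum => i _.
pose upd (y : Om * ('I_R * {ffun 'I_w -> 'I_Q})) : Om :=
  (y.2.1, [ffun x => if x.1 == i then y.2.2 x.2 else y.1.2 x]).
pose X := finset.setX [set o : Om | slot o i == p] [set: 'I_R * {ffun 'I_w -> 'I_Q}].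
have cX : #|X| = #|[set o : Om | slot o i == p]| * (R * Q ^ w).
  by rewrite cardsX cardsT card_prod card_ffun !card_ord.
rewrite -cX -(@card_in_imset _ _ upd X) ?max_card //.
move=> [[j d] [j1 a]] [[j' d'] [j1' a']]; rewrite !inE !andbT /=.
move=> /eqP sp /eqP sp' [-> e].
have /split_slot[] := congr1 val (etrans sp (esym sp')); rewrite ?row_lt //=.
move=> be re.
have jj : j = j'.
  apply: val_inj; move/eqP: re; rewrite /row eqn_modDr !modn_small ?ltn_ord //.
  by move/eqP.
have dd k : d (i, k) = d' (i, k).
  apply: val_inj; rewrite /= -(extendE (fun k => d (i, k))) -(extendE (fun k => d' (i, k))).
  by apply: (number_inj _ _ be) => // k'; exact: extend_lt.
have eE x : (if x.1 == i then a x.2 else d x) = (if x.1 == i then a' x.2 else d' x).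
  by have := congr1 (fun f : {ffun 'I_h * 'I_w -> 'I_Q} => f x) e; rewrite !ffunE.
rewrite jj; congr ((_, _), (_, _)); apply/ffunP.
  move=> [i0 k]; have := eE (i0, k) => /=; case: eqP => [-> _|] //.
by move=> k; have := eE (i, k); rewrite /= eqxx.
Qed.

End MainRows.

(** The loss [1 - 1 / B] comes from [N * (Q ^ R %/ N) > Q ^ R - N] and [B * N <= Q ^ R]. The factor
    [R.+1 / R] is the price of the extra row, which takes up time in the window without being
    sampled. *)
Lemma rotation_routing (K : realType) (N R Q l w h B : nat)
  (s := rotation_schedule N R Q l) :
  1 < N -> 0 < Q -> 0 < l -> 0 < R -> 0 < w -> w <= R ->
  R <= h * w -> h.-1 * w < R -> 1 < B -> B * N <= Q ^ R ->
  exists f : dpath 'Z_N -> \bar K,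
  [/\ oblivious_routing (shift_schedule s) f,
      forall r : K, (r * (2 * h%:R * R.+1%:R) <= R%:R * (1 - B%:R^-1))%R ->
        guarantees_throughput (shift_schedule s) f r &
      (max_latency f <= (3 * (R.+1 * Q ^ w))%:R%:E)%E].
Proof.
move=> N_gt1 Q_gt0 l_gt0 R_gt0 w_gt0 w_le hw_ge hw_lt B_gt1 BN.
have L_gt0 : 0 < R.+1 * Q ^ w by rewrite muln_gt0 expn_gt0 Q_gt0.
have M_gt0 : 0 < Q ^ (R - w) * l by rewrite muln_gt0 expn_gt0 Q_gt0.
pose kap : K := (1 - B%:R^-1)%R; pose lam : K := (h%:R / (R * Q ^ w)%:R)%R.
have B0 : (0 < B%:R :> K)%R by rewrite ltr0n; lia.
have kap_gt0 : (0 < kap)%R by rewrite subr_gt0 invf_lt1 // ltr1n.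
have RQ0 : (0 < (R * Q ^ w)%:R :> K)%R by rewrite ltr0n muln_gt0 R_gt0 expn_gt0 Q_gt0.
have Om_gt0 : 0 < #|{: 'I_R * {ffun 'I_h * 'I_w -> 'I_Q}}|.
  by rewrite card_samples muln_gt0 R_gt0 expn_gt0 Q_gt0.
have [||f [f1 f2 f3]] := @sampled_routing K N s _ _ L_gt0 M_gt0
    (size_schedule_blocks N Q l w_le) _ (@slots R Q w h Q_gt0 R_gt0) kap lam Om_gt0 kap_gt0.
- move=> u x; have cV : #|'Z_N| = N by rewrite card_ord Zp_cast.
  rewrite cV {cV}.
  move: (cover_slots Q_gt0 R_gt0 w_le w_gt0 hw_lt hw_ge N_gt1 l_gt0 u x).
  move: #|[set o | _]| #|{: _ * _}| => n O cov.
  have QN : B.-1 * Q ^ R <= B * (N * (Q ^ R %/ N)).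
    have := divn_eq (Q ^ R) N; have : Q ^ R %% N < N by apply: ltn_pmod; lia.
    set q := _ %/ _ => mN e; nia.
  have : B.-1 * O <= B * (N * n).
    have P0 : 0 < Q ^ R by rewrite expn_gt0 Q_gt0.
    rewrite -(leq_pmul2l P0).
    have := leq_mul (leqnn O) QN; have := leq_mul (leqnn (B * N)) cov.
    move: (Q ^ R %/ N) (Q ^ R) B.-1 => q P b; nia.
  rewrite -(ler_nat K) !natrM => h1.
  rewrite -(ler_pM2l B0); apply: le_trans h1.
  rewrite mulrA ler_wpM2r // /kap mulrBr mulr1 mulfV ?gt_eqF //.
  by rewrite -subn1 natrB // ltnW.
- move=> p; rewrite /lam mulrAC (ler_pdivlMr _ _ RQ0) -!natrM ler_nat.
  exact: load_slots.
exists f; split => // r rle; apply: f2.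
have R0 : (0 < R%:R :> K)%R by rewrite ltr0n.
have Q0 : ((Q ^ w)%:R != 0 :> K)%R by rewrite pnatr_eq0 -lt0n expn_gt0 Q_gt0.
have -> : (2 * (R.+1 * Q ^ w)%:R * (lam / kap) = 2 * h%:R * R.+1%:R / (R%:R * kap))%R.
  by rewrite /lam !natrM; field; rewrite Q0 !gt_eqF.
by rewrite mulrA ler_pdivrMr ?mul1r // mulr_gt0.
Qed.

(** By binary expansion, every residue is a sum of some of the powers [2 ^ k] with [k < l], each of
    which the extra row offers once in a window of [l] counter values. *)
Lemma power_routing (K : realType) (N R Q l : nat) (s := rotation_schedule N R Q l) :
  1 < N -> 0 < Q -> 0 < l -> N <= 2 ^ l ->
  exists f : dpath 'Z_N -> \bar K,
  [/\ oblivious_routing (shift_schedule s) f,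
      forall r : K, (r <= 0)%R ->
        guarantees_throughput (shift_schedule s) f r &
      (max_latency f <= (3 * (R.+1 * l))%:R%:E)%E].
Proof.
move=> N_gt1 Q_gt0 l_gt0 Nl.
have L_gt0 : 0 < R.+1 * l by rewrite muln_gt0.
have M_gt0 : 0 < Q ^ R by rewrite expn_gt0 Q_gt0.
have sizes : size s = Q ^ R * (R.+1 * l) by rewrite size_rotation_schedule; ring.
have slot_lt (k : 'I_l) : R.+1 * k + R < R.+1 * l.
  by apply: leq_trans (_ : R.+1 * k.+1 <= _); rewrite ?leq_pmul2l // mulnS; lia.
pose slot (k : 'I_l) : 'I_(R.+1 * l) := Ordinal (slot_lt k).
have slot_inj : injective slot.
  by move=> k k' [] /addIn/eqP; rewrite eqn_pmul2l // => /eqP/val_inj.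
pose Om : finType := {ffun 'I_l -> 'I_2}.
pose S (o : Om) : {set 'I_(R.+1 * l)} := [set slot k | k in [pred k | o k != ord0]].
have Om_gt0 : 0 < #|Om| by rewrite card_ffun !card_ord expn_gt0.
(* With this value the covering condition says that every residue is attained at least once, which
   suffices for [r <= 0]. *)
pose kap : K := (#|'Z_N|%:R / #|Om|%:R)%R.
have Om0 : (0 < #|Om|%:R :> K)%R by rewrite ltr0n.
have V0 : (0 < #|'Z_N|%:R :> K)%R by rewrite ltr0n card_ord.
have kap_gt0 : (0 < kap)%R by rewrite divr_gt0.
have [||f [f1 f2 f3]] := @sampled_routing K N s _ _ L_gt0 M_gt0 sizes _ S kap 1%R Om_gt0 kap_gt0.
- move=> u x; rewrite /kap divfK ?gt_eqF //; apply: ler_peMr; [exact: ltW | rewrite ler1n].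
  have [u' sE] := shift_at_block u sizes M_gt0.
  have : 0 < 2 ^ l %/ N by rewrite divn_gt0 // ltnW.
  move=> /leq_trans/(_ (card_number l N_gt1 (isT : 0 < 2) x))/card_gt0P[a].
  rewrite inE => /eqP ax; apply/card_gt0P; exists a; rewrite inE -ax; apply/eqP.
  rewrite /sample_shift /S big_imset /=; last by move=> ? ? _ _; apply: slot_inj.
  rewrite natr_sum big_mkcond /=; apply: eq_bigr => k _.
  rewrite sE //.
  have -> : u' * (R.+1 * l) + (R.+1 * k + R) = R.+1 * (u' * l + k) + R by ring.
  rewrite shift_value_row // ltnn modnMDl modn_small // inE.
  by case: (a k) => -[|[|//]] /= _; rewrite ?mul0n ?mul1n.
- by move=> p; rewrite mul1r ler_nat max_card.
exists f; split => // r rle; apply: f2.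
apply: (@le_trans _ _ 0%R) => //; rewrite mulr_le0_ge0 // !mulr_ge0 // invr_ge0 ltW //.
Qed.

(** * A program for the schedule *)

Definition runs (c : cmd) (m : memory) (t : nat) (m' : memory) : Prop :=
  exists2 n, n <= t & exec c m n m'.

Lemma runs_le c m t t' m' : runs c m t m' -> t <= t' -> runs c m t' m'.
Proof. by move=> [n nt ex] tt'; exists n => //; apply: leq_trans tt'. Qed.

Lemma runs_eq c m t m' t1 m1 : runs c m t m' -> m' = m1 -> t <= t1 -> runs c m t1 m1.
Proof. by move=> r <-; apply: runs_le. Qed.

Lemma runs_seq c1 c2 m t1 m1 t2 m2 :
  runs c1 m t1 m1 -> runs c2 m1 t2 m2 -> runs (CSeq c1 c2) m (t1 + t2) m2.
Proof.
move=> [n1 l1 e1] [n2 l2 e2]; exists (n1 + n2); first exact: leq_add.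
exact: exec_seq e1 e2.
Qed.

Lemma runs_if e c1 c2 m t m' :
  runs (if eval m e != 0 then c1 else c2) m t m' ->
  runs (CIf e c1 c2) m (ecost e + t).+1 m'.
Proof.
move=> [n l ex]; exists (ecost e + n).+1; first by rewrite ltnS leq_add2l.
exact: exec_if.
Qed.

Lemma runs_while e c (st : nat -> memory) n b m t m' :
  (forall i, i < n -> eval (st i) e != 0) ->
  (forall i, i < n -> runs c (st i) b (st i.+1)) ->
  eval (st n) e = 0 -> m = st 0 -> st n = m' -> n.+1 * (ecost e + b).+1 <= t ->
  runs (CWhile e c) m t m'.
Proof.
move=> guard body stop -> <-; apply: runs_le.
elim: n st guard body stop => [|n IH] st guard body stop.
  by exists (ecost e).+1; [rewrite mul1n ltnS leq_addr | exact: exec_while_stop].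
have [k kb ek] := body 0 isT.
have [||//|n' n'b e'] := IH (fun i => st i.+1).
- by move=> i ni; apply: guard.
- by move=> i ni; apply: body.
exists (ecost e + k + n').+1; last by apply: exec_while_step ek e'; apply: guard.
by rewrite mulSn -addSn leq_add // ltnS leq_add2l.
Qed.

(** Listing the variables in front of the output area lets reads and assignments of variables be
    evaluated by reduction. *)
Fixpoint split_memory (vs : seq nat) (out : nat -> nat) : memory :=
  fun a => if vs is v :: vs' then
             if a is a'.+1 then split_memory vs' out a' else v
           else out a.

Notation "# i" := (ELoad (EConst i)) (at level 9, format "# i").
Notation asn i e := (CStore (EConst i) e).
Notation "c1 ;; c2" := (CSeq c1 c2) (at level 61, right associativity).

Lemma runs_asn i e vs out : i < size vs ->
  runs (asn i e) (split_memory vs out) (ecost e).+2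
    (split_memory (set_nth 0 vs i (eval (split_memory vs out) e)) out).
Proof.
move=> ivs; exists (ecost e).+2 => //.
set x := eval _ e.
rewrite (_ : split_memory (set_nth _ _ _ _) _ = [eta split_memory vs out with i |-> x]).
  exact: (exec_store (EConst i)).
apply/funext => a /=; elim: vs i a ivs {x} (x) => [//|v vs IH] [|i] [|a] //= ivs x.
by rewrite IH.
Qed.

Lemma runs_out e1 e2 vs out o : eval (split_memory vs out) e1 = size vs + o ->
  runs (CStore e1 e2) (split_memory vs out) (ecost e1 + ecost e2).+1
    (split_memory vs [eta out with o |-> eval (split_memory vs out) e2]).
Proof.
move=> e1o; exists (ecost e1 + ecost e2).+1 => //.
have := exec_store e1 e2 (split_memory vs out); rewrite e1o.
set x := eval _ e2; congr exec; apply/funext => a /=.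
elim: vs a {e1o x} (x) => [//|v vs IH] [|a] x //=.
by rewrite addSn eqSS -IH.
Qed.

Fixpoint emul (n : nat) (e : expr) : expr :=
  if n is n'.+1 then EAdd e (emul n' e) else EConst 0.

Lemma eval_emul m n e : eval m (emul n e) = n * eval m e.
Proof. by elim: n => //= n ->. Qed.

Lemma ecost_emul n e : ecost (emul n e) = (n * (ecost e).+1).+1.
Proof. by elim: n => //= n ->; lia. Qed.

(* The cells are 0: number of items written; 1: [N]; 2: [R]; 3: [Q]; 4: [Q ^ R];
   5: counter; 6: current row; 7: rotated counter; 8: power of two;
   9: size of the output; 10, 11, 12: scratch. *)
Definition state (ptr N R Q P v rho x p T y z u : nat) (out : nat -> nat) : memory :=
  split_memory [:: ptr; N; R; Q; P; v; rho; x; p; T; y; z; u] out.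

Ltac step := apply: runs_seq; first by apply: runs_asn.

Definition cmd_power : cmd :=
  asn 10 (EConst 1);; asn 11 #2;;
  CWhile #11
    (asn 12 #3;; asn 7 (EConst 0);;
     CWhile #12 (asn 7 (EAdd #7 #10);; asn 12 (ESub #12 (EConst 1)));;
     asn 10 #7;; asn 11 (ESub #11 (EConst 1)));;
  asn 4 #10;; asn 7 (EConst 0);; asn 10 (EConst 0);; asn 12 (EConst 0).

Ltac straight := apply: runs_eq; first (repeat step; apply: runs_asn => //).
Ltac same_state := rewrite /state /=;
  congr (split_memory [:: _; _; _; _; _; _; _; _; _; _; _; _; _] _).

Ltac guard_ok := let i := fresh "i" in let iQ := fresh "iQ" in
  move=> i iQ; rewrite /state /=; lia.

Lemma runs_power ptr N R Q P v rho x p T y z u out :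
  runs cmd_power (state ptr N R Q P v rho x p T y z u out)
    (60 * (R.+1 * Q.+1)) (state ptr N R Q (Q ^ R) v rho 0 p T 0 0 0 out).
Proof.
have inner y' z' : runs (CWhile #12 (asn 7 (EAdd #7 #10);; asn 12 (ESub #12 (EConst 1))))
    (state ptr N R Q P v rho 0 p T y' z' Q out) (Q.+1 * 17)
    (state ptr N R Q P v rho (Q * y') p T y' z' 0 out).
  apply: (runs_while (n := Q) (b := 14)
    (st := fun i => state ptr N R Q P v rho (i * y') p T y' z' (Q - i) out)) => //.
  - guard_ok.
  - move=> i iQ; straight; last by [].
    by same_state; lia.
  - by rewrite /state /= subnn.
  - by rewrite mul0n subn0.
  - by rewrite subnn.
have outer : runs (CWhile #11 (asn 12 #3;; asn 7 (EConst 0);;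
     CWhile #12 (asn 7 (EAdd #7 #10);; asn 12 (ESub #12 (EConst 1)));;
     asn 10 #7;; asn 11 (ESub #11 (EConst 1))))
    (state ptr N R Q P v rho x p T 1 R u out) (R.+1 * (17 * Q.+1 + 23))
    (state ptr N R Q P v rho (if R is 0 then x else Q ^ R) p T (Q ^ R)
           0 (if R is 0 then u else 0) out).
  (* Cells 7 and 12 keep their old contents until the first round, hence the cases on [i]. *)
  apply: (runs_while (n := R) (b := 17 * Q.+1 + 20)
    (st := fun i => state ptr N R Q P v rho (if i is 0 then x else Q ^ i) p T (Q ^ i)
                      (R - i) (if i is 0 then u else 0) out)).
  - guard_ok.
  - move=> i iR; apply: runs_eq.
    + step; step; apply: runs_seq; first exact: inner.
      by step; apply: runs_asn.
    + by same_state; rewrite ?expnS //; lia.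
    + by rewrite /=; lia.
  - by rewrite /state /= subnn.
  - by rewrite subn0.
  - by rewrite subnn.
  - by rewrite /= leq_mul2l; lia.
apply: runs_eq.
- step; step; apply: runs_seq; first exact: outer.
  by step; step; step; apply: runs_asn.
- by same_state.
- by rewrite /=; lia.
Qed.

Definition cmd_search (B dR dQ : nat) : cmd :=
  cmd_power;;
  CWhile (ESub (emul B #1) #4)
    (asn 2 (EAdd #2 (EConst dR));; asn 3 (EAdd #3 (EConst dQ));; cmd_power).

Lemma runs_search B dR dQ J ptr N R Q P v rho x p T y z u out :
  (forall j, j < J -> (Q + j * dQ) ^ (R + j * dR) < B * N) ->
  B * N <= (Q + J * dQ) ^ (R + J * dR) ->
  runs (cmd_search B dR dQ) (state ptr N R Q P v rho x p T y z u out)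
    (J.+2 * (60 * ((R + J * dR).+1 * (Q + J * dQ).+1) + 3 * B + 20))
    (state ptr N (R + J * dR) (Q + J * dQ) ((Q + J * dQ) ^ (R + J * dR))
       v rho 0 p T 0 0 0 out).
Proof.
move=> before after.
apply: runs_eq; first (apply: runs_seq; first exact: runs_power).
- apply: (runs_while (n := J) (b := 60 * ((R + J * dR).+1 * (Q + J * dQ).+1) + 12)
    (t := J.+1 * (60 * ((R + J * dR).+1 * (Q + J * dQ).+1) + 3 * B + 20))
    (st := fun i => state ptr N (R + i * dR) (Q + i * dQ)
       ((Q + i * dQ) ^ (R + i * dR)) v rho 0 p T 0 0 0 out)) => [i iJ|i iJ|||//|].
  + by rewrite /= eval_emul /state /=; have := before i iJ; lia.
  + apply: runs_eq.
    * step; step; exact: runs_power.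
    * rewrite /state /=; have -> : (R + i * dR + dR = R + i.+1 * dR)%N by lia.
      have -> : (Q + i * dQ + dQ = Q + i.+1 * dQ)%N by lia.
      by [].
    * rewrite /=; suff: (R + i * dR + dR).+1 * (Q + i * dQ + dQ).+1 <=
        (R + J * dR).+1 * (Q + J * dQ).+1 by lia.
      by rewrite leq_mul // ltnS -addnA leq_add2l addnC -mulSn leq_mul2r iJ orbT.
  + by rewrite /= eval_emul /state /=; lia.
  + by rewrite !mul0n !addn0.
  + by rewrite leq_mul2l /= ecost_emul /=; lia.
- by [].
- rewrite [leqRHS]mulSn leq_add2r; suff : R.+1 * Q.+1 <= (R + J * dR).+1 * (Q + J * dQ).+1 by lia.
  by rewrite leq_mul // ltnS leq_addr.
Qed.

(** Doubling 1 until it reaches [N] takes [up_log 2 N] rounds, so adding [R.+1 * Q ^ R] in each of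
    them gives the period without any multiplication. *)
Definition cmd_total : cmd :=
  asn 9 (EConst 0);; asn 8 (EConst 1);;
  CWhile (ESub #1 #8)
    (asn 11 (EAdd #2 (EConst 1));;
     CWhile #11 (asn 9 (EAdd #9 #4);; asn 11 (ESub #11 (EConst 1)));;
     asn 8 (EAdd #8 #8));;
  asn 8 (EConst 1).

Lemma runs_total ptr N R Q P v rho x p T y u out :
  runs cmd_total (state ptr N R Q P v rho x p T y 0 u out)
    (60 * (up_log 2 N).+1 * R.+3)
    (state ptr N R Q P v rho x 1 (R.+1 * P * up_log 2 N) y 0 u out).
Proof.
set l := up_log 2 N.
have below i : i < l -> 2 ^ i < N.
  by move=> il; rewrite ltnNge; apply: contraL il => /up_log_min; rewrite -leqNgt; apply.
have inner p' T' : runs (CWhile #11 (asn 9 (EAdd #9 #4);; asn 11 (ESub #11 (EConst 1))))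
    (state ptr N R Q P v rho x p' T' y R.+1 u out) (R.+2 * 17)
    (state ptr N R Q P v rho x p' (T' + R.+1 * P) y 0 u out).
  apply: (runs_while (n := R.+1) (b := 14)
    (st := fun i => state ptr N R Q P v rho x p' (T' + i * P) y (R.+1 - i) u out)) => //.
  - guard_ok.
  - move=> i iQ; straight; last by [].
    by same_state; lia.
  - by rewrite /state /= subnn.
  - by rewrite mul0n addn0 subn0.
  - by rewrite subnn.
have outer : runs (CWhile (ESub #1 #8)
    (asn 11 (EAdd #2 (EConst 1));;
     CWhile #11 (asn 9 (EAdd #9 #4);; asn 11 (ESub #11 (EConst 1)));;
     asn 8 (EAdd #8 #8)))
    (state ptr N R Q P v rho x 1 0 y 0 u out) (l.+1 * (R.+2 * 17 + 22))
    (state ptr N R Q P v rho x (2 ^ l) (R.+1 * P * l) y 0 u out).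
  apply: (runs_while (n := l) (b := R.+2 * 17 + 16)
    (st := fun i => state ptr N R Q P v rho x (2 ^ i) (R.+1 * P * i) y 0 u out))
     => [i il|i il|||//|].
  - by rewrite /state /=; have := below i il; lia.
  - apply: runs_eq.
    + step; apply: runs_seq; first by rewrite /= addn1; exact: inner.
      by apply: runs_asn.
    + by same_state; rewrite ?expnS; lia.
    + by rewrite /=; lia.
  - rewrite /state /=; have := @up_logP 2 N isT; rewrite -/l; lia.
  - by rewrite muln0.
  - by rewrite leq_mul2l /=; lia.
apply: runs_eq.
- step; step; apply: runs_seq; first exact: outer.
  by apply: runs_asn.
- by same_state.
- by rewrite /=; lia.
Qed.

Lemma number_digit Q m v : 0 < Q -> number Q m (fun k => digit Q k v) = v %% Q ^ m.
Proof.
move=> Q_gt0; elim: m => [|m IH]; first by rewrite /number big_ord0 modn1.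
rewrite /number big_ord_recr /= -/(number Q m (fun k => digit Q k v)) IH /digit expnS.
have Qm : 0 < Q ^ m by rewrite expn_gt0 Q_gt0.
set q := v %/ Q ^ m; set r := v %% Q ^ m.
have -> : v = (q %/ Q) * (Q * Q ^ m) + (r + q %% Q * Q ^ m).
  rewrite {1}(divn_eq v (Q ^ m)) -/q -/r {1}(divn_eq q Q); ring.
rewrite modnMDl [RHS]modn_small //.
apply: (@leq_trans ((q %% Q).+1 * Q ^ m)).
  by rewrite mulSn ltn_add2r ltn_pmod.
by rewrite leq_mul2r ltn_pmod // orbT.
Qed.

Lemma rotated0 R Q v : 0 < Q -> rotated R Q 0 v = v %% Q ^ R.
Proof.
move=> Q_gt0; rewrite -number_digit //; apply: eq_bigr => k _.
by rewrite addn0 modn_small.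
Qed.

Lemma rotated_zero R Q rho : rotated R Q rho 0 = 0.
Proof. by apply: big1 => k _; rewrite /digit div0n mod0n mul0n. Qed.

Lemma rotated_lt R Q rho v : 0 < Q -> rotated R Q rho v < Q ^ R.
Proof.
move=> Q_gt0; case: R => [|R]; first by rewrite /rotated big_ord0.
pose h (k : 'I_R.+1) : 'I_R.+1 := Ordinal (ltn_pmod (k + rho) (ltn0Sn R)).
have h_inj : injective h.
  move=> k k' [] /eqP; rewrite eqn_modDr !modn_small ?ltn_ord // => /eqP.
  exact: val_inj.
apply: leq_ltn_trans (_ : \sum_(k < R.+1) Q.-1 * Q ^ k < _).
  rewrite [leqRHS](reindex_inj h_inj) /=; apply: leq_sum => k _.
  by rewrite leq_mul2r -ltnS prednK // ltn_pmod ?orbT.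
by apply: (@number_lt Q (fun=> Q.-1)) => k; rewrite prednK.
Qed.

(** Multiplication by [Q] moves all digits up one place; the top digit [d] must go from [Q ^ R] back
    to place 0, a difference of [d * (Q ^ R).-1]. Since [d] is then the digit at place 0, it is at
    most the new number. *)
Lemma rotated_step R Q rho v : 0 < Q -> exists2 d,
  Q * rotated R Q rho v = rotated R Q rho.+1 v + d * (Q ^ R).-1 & d <= rotated R Q rho.+1 v.
Proof.
move=> Q_gt0; exists (\sum_(k < R | (k + rho) %% R == R.-1) digit Q k v); last first.
  rewrite /rotated big_mkcond /=; apply: leq_sum => k _.
  by case: ifP => // _; rewrite leq_pmulr // expn_gt0 Q_gt0.
rewrite /rotated big_distrr big_distrl /= [X in _ + X]big_mkcond /= -big_split /=.
apply: eq_bigr => k _; have R_gt0 : 0 < R by apply: leq_ltn_trans (ltn_ord k).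
have -> : (k + rho.+1) %% R = ((k + rho) %% R).+1 %% R 
  by rewrite addnS -(addn1 (k + rho)) -(addn1 (_ %% R)) modnDml.
have := ltn_pmod (k + rho) R_gt0; case: eqP => [-> _|ne lt].
  rewrite prednK // modnn muln1.
  by rewrite mulnCA -expnS prednK // -{1}[Q ^ R]prednK ?expn_gt0 ?Q_gt0 // mulnS.
rewrite [_.+1 %% R]modn_small ?addn0 ?expnS 1?mulnCA //.
by move: ne lt; move: (_ %% _) => z; lia.
Qed.

Definition cmd_row : cmd :=
  asn 10 #7;;
  CWhile (ESub (EAdd #10 (EConst 1)) #1) (asn 10 (ESub #10 #1));;
  CStore (EAdd #0 (EConst 1)) #10;;
  asn 10 (EConst 0);; asn 11 #3;;
  CWhile #11 (asn 10 (EAdd #10 #7);; asn 11 (ESub #11 (EConst 1)));;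
  asn 7 #10;; asn 10 (EConst 0);;
  CWhile (ESub (EAdd #7 (EConst 1)) #4) (asn 7 (ESub (EAdd #7 (EConst 1)) #4));;
  asn 6 (EAdd #6 (EConst 1)).

Lemma runs_row o N R Q P v rho x x' d p T out :
  0 < N -> 1 < P -> x < P -> x' < P -> Q * x = x' + d * P.-1 -> d <= x' ->
  runs cmd_row (state (12 + o) N R Q P v rho x p T 0 0 0 out) (40 * (P + P + Q + 4))
    (state (12 + o) N R Q P v rho.+1 x' p T 0 0 0 [eta out with o |-> x %% N]).
Proof.
move=> N_gt0 P_gt1 xP x'P xE dx'.
have reduce : runs (CWhile (ESub (EAdd #10 (EConst 1)) #1) (asn 10 (ESub #10 #1)))
    (state (12 + o) N R Q P v rho x p T x 0 0 out) (P.+1 * 15)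
    (state (12 + o) N R Q P v rho x p T (x %% N) 0 0 out).
  apply: (runs_while (n := x %/ N) (b := 7)
    (st := fun i => state (12 + o) N R Q P v rho x p T (x - i * N) 0 0 out)).
  - move=> i iN; rewrite /state /=.
    have : i.+1 * N <= x by rewrite -leq_divRL.
    by rewrite mulSn; lia.
  - move=> i iN; straight; last by [].
    by same_state; lia.
  - rewrite /state /=; have := divn_eq x N; have := ltn_pmod x N_gt0; lia.
  - by rewrite mul0n subn0.
  - by have -> : x - x %/ N * N = x %% N by have := divn_eq x N; lia.
  - rewrite /= leq_mul //; have := leq_div x N; lia.
have multiply out' : runs (CWhile #11 (asn 10 (EAdd #10 #7);; asn 11 (ESub #11 (EConst 1))))
    (state (12 + o) N R Q P v rho x p T 0 Q 0 out') (Q.+1 * 17)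
    (state (12 + o) N R Q P v rho x p T (Q * x) 0 0 out').
  apply: (runs_while (n := Q) (b := 14)
    (st := fun i => state (12 + o) N R Q P v rho x p T (i * x) (Q - i) 0 out')) => //.
  - guard_ok.
  - move=> i iQ; straight; last by [].
    by same_state; lia.
  - by rewrite /state /= subnn.
  - by rewrite subn0.
  - by rewrite subnn.
have wrap out' : runs
    (CWhile (ESub (EAdd #7 (EConst 1)) #4) (asn 7 (ESub (EAdd #7 (EConst 1)) #4)))
    (state (12 + o) N R Q P v rho (Q * x) p T 0 0 0 out') (P.+1 * 17)
    (state (12 + o) N R Q P v rho x' p T 0 0 0 out').
  (* The loop runs while the value is at least [P]. If a subtraction of [P.-1] is still due, then
     [1 <= d <= x'], so the value is at least [x' + P.-1 >= P]; at the end it is [x' < P]. *)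
  apply: (runs_while (n := d) (b := 9)
    (st := fun i => state (12 + o) N R Q P v rho (Q * x - i * P.-1) p T 0 0 0 out')).
  - move=> i id; rewrite /state /= xE.
    have : i.+1 * P.-1 <= d * P.-1 by rewrite leq_mul2r id orbT.
    by rewrite mulSn; lia.
  - move=> i id; straight; last by [].
    by same_state; rewrite mulSn; lia.
  - by rewrite /state /= xE addnK; lia.
  - by rewrite mul0n subn0.
  - by rewrite xE addnK.
  - by rewrite /= leq_mul //; lia.
apply: runs_eq.
- step; apply: runs_seq; first exact: reduce.
  (* Item [t] belongs in cell [t.+1]; for [t = 12 + o] this is position [o] behind the 13
     variables. *)
  apply: runs_seq; first by apply: (@runs_out _ _ _ _ o); rewrite /= addn1.
  step; step; apply: runs_seq; first exact: multiply.
  step; step; apply: runs_seq; first exact: wrap.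
  by apply: runs_asn.
- by same_state; rewrite addn1.
- by rewrite /=; lia.
Qed.

(** Resetting the power of two to 1 when its double reaches [N] reduces the exponent modulo
    [up_log 2 N]. The counter may wrap at [Q ^ R] because only its [R] low digits enter the
    rotations. *)
Definition cmd_extra : cmd :=
  CStore (EAdd #0 (EConst 1)) #8;;
  asn 8 (EAdd #8 #8);;
  CIf (ESub (EAdd #8 (EConst 1)) #1) (asn 8 (EConst 1)) CSkip;;
  asn 5 (EAdd #5 (EConst 1));;
  CIf (ESub (EAdd #5 (EConst 1)) #4) (asn 5 (EConst 0)) CSkip;;
  asn 7 #5;; asn 6 (EConst 0).

Lemma runs_skip m : runs CSkip m 1 m.
Proof. by exists 1; last exact: exec_skip. Qed.

Lemma runs_extra o N R Q P v rho x p T out :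
  runs cmd_extra (state (12 + o) N R Q P v rho x p T 0 0 0 out) 100
    (state (12 + o) N R Q P (if P <= v.+1 then 0 else v.+1) 0
       (if P <= v.+1 then 0 else v.+1)
       (if N <= p + p then 1 else p + p) T 0 0 0 [eta out with o |-> p]).
Proof.
pose p' := if N <= p + p then 1 else p + p; pose v' := if P <= v.+1 then 0 else v.+1.
have if1 out' : runs (CIf (ESub (EAdd #8 (EConst 1)) #1) (asn 8 (EConst 1)) CSkip)
    (state (12 + o) N R Q P v rho x (p + p) T 0 0 0 out') 20
    (state (12 + o) N R Q P v rho x p' T 0 0 0 out').
  have e : eval (state (12 + o) N R Q P v rho x (p + p) T 0 0 0 out')
    (ESub (EAdd #8 (EConst 1)) #1) != 0 = (N <= p + p).
    by rewrite /state /=; apply/idP/idP; lia.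
  apply: runs_le; first (apply: runs_if; rewrite e /p'; case: ifP => _).
  - by apply: runs_asn.
  - by apply: runs_le (runs_skip _) _; exact: (isT : 1 <= 3).
  - by [].
have if2 out' : runs (CIf (ESub (EAdd #5 (EConst 1)) #4) (asn 5 (EConst 0)) CSkip)
    (state (12 + o) N R Q P v.+1 rho x p' T 0 0 0 out') 20
    (state (12 + o) N R Q P v' rho x p' T 0 0 0 out').
  have e : eval (state (12 + o) N R Q P v.+1 rho x p' T 0 0 0 out')
    (ESub (EAdd #5 (EConst 1)) #4) != 0 = (P <= v.+1).
    by rewrite /state /=; apply/idP/idP; lia.
  apply: runs_le; first (apply: runs_if; rewrite e /v'; case: ifP => _).
  - by apply: runs_asn.
  - by apply: runs_le (runs_skip _) _; exact: (isT : 1 <= 3).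
  - by [].
apply: runs_eq.
- apply: runs_seq; first by apply: (@runs_out _ _ _ _ o); rewrite /= addn1.
  step; apply: runs_seq; first exact: if1.
  step; apply: runs_seq; first by rewrite /= addn1; exact: if2.
  by step; apply: runs_asn.
- by [].
- by [].
Qed.

Definition cmd_main : cmd :=
  CWhile (ESub #9 #0)
    (CIf (ESub #2 #6) cmd_row cmd_extra;; asn 0 (EAdd #0 (EConst 1))).

Section MainLoop.
Variables (N R Q : nat).
Hypotheses (N_gt1 : 1 < N) (Q_gt1 : 1 < Q) (R_ge : 12 <= R).
Local Notation P := (Q ^ R).
Local Notation l := (up_log 2 N).
Local Notation T := (R.+1 * P * l).

(** The area behind the variables begins with item 12. *)
Definition written (out : nat -> nat) (t o : nat) : nat :=
  if o < t - 12 then shift_value R Q l (o + 12) %% N else out o.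

Definition snapshot (out : nat -> nat) (t : nat) : memory :=
  state t N R Q P ((t %/ R.+1) %% P) (t %% R.+1)
    (rotated R Q (t %% R.+1) (t %/ R.+1)) (2 ^ ((t %/ R.+1) %% l)) T 0 0 0
    (written out t).

Lemma Q_le_P : Q <= P.
Proof. by rewrite -{1}[Q]expn1 leq_exp2l //; lia. Qed.

Lemma written_succ out t x : 12 <= t -> shift_value R Q l t %% N = x ->
  [eta written out t with t - 12 |-> x] = written out t.+1 :> (nat -> nat).
Proof.
move=> t12 <-; apply/funext => o /=; rewrite /written subSn //.
case: eqP => [->|/eqP ne]; first by rewrite ltnSn subnK.
by rewrite ltnS [in RHS]leq_eqVlt (negPf ne).
Qed.

Lemma divn_succ q rho : rho < R -> ((R.+1 * q + rho).+1 %/ R.+1 = q)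
  * ((R.+1 * q + rho).+1 %% R.+1 = rho.+1).
Proof.
move=> rR; rewrite -addnS mulnC divnMDl // modnMDl.
by rewrite divn_small ?modn_small ?addn0.
Qed.

Lemma divn_wrap q : ((R.+1 * q + R).+1 %/ R.+1 = q.+1)
  * ((R.+1 * q + R).+1 %% R.+1 = 0).
Proof. by rewrite -addnS -mulnSr mulKn // modnMr. Qed.

Lemma runs_iteration out t : 12 <= t ->
  runs (CIf (ESub #2 #6) cmd_row cmd_extra;; asn 0 (EAdd #0 (EConst 1)))
    (snapshot out t) (120 * P + 300) (snapshot out t.+1).
Proof.
move=> t12.
have Q_gt0 : 0 < Q by lia.
have P_gt1 : 1 < P by apply: leq_trans Q_gt1 Q_le_P.
have QP := Q_le_P; have l0 : 0 < l by rewrite up_log_gt0.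
have [q [rho [tE rhoR]]] : exists q rho, t = R.+1 * q + rho /\ rho < R.+1.
  by exists (t %/ R.+1), (t %% R.+1); rewrite mulnC -divn_eq ltn_pmod.
have tq : t %/ R.+1 = q by rewrite tE mulnC divnMDl // divn_small ?addn0.
have tr : t %% R.+1 = rho by rewrite tE mulnC modnMDl modn_small.
have sv := shift_value_row Q l q rhoR; rewrite -tE in sv.
have to : 12 + (t - 12) = t by rewrite subnKC.
have guard : eval (snapshot out t) (ESub #2 #6) != 0 = (rho < R).
  by rewrite /snapshot /state /= tr; apply/idP/idP; lia.
have branch : runs (if rho < R then cmd_row else cmd_extra) (snapshot out t)
    (120 * P + 260)
    (state t N R Q P ((t.+1 %/ R.+1) %% P) (t.+1 %% R.+1)
       (rotated R Q (t.+1 %% R.+1) (t.+1 %/ R.+1)) (2 ^ ((t.+1 %/ R.+1) %% l)) T 0 0 0 (written out t.+1)).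
  rewrite /snapshot tq tr; case: ltnP sv => [rR sv|Rr sv].
    rewrite tE !divn_succ // -tE.
    have [d dE dle] := @rotated_step R Q rho q Q_gt0.
    have := @runs_row (t - 12) N R Q P (q %% P) rho _ _ d (2 ^ (q %% l)) T (written out t)
      (ltnW N_gt1) P_gt1 (rotated_lt R rho q Q_gt0) (rotated_lt R rho.+1 q Q_gt0) dE dle.
    rewrite to => h; apply: runs_eq h _ _; last by lia.
    by rewrite written_succ // sv.
  have rE : rho = R by lia.
  have [-> ->] : t.+1 %/ R.+1 = q.+1 /\ t.+1 %% R.+1 = 0.
    by rewrite tE rE !divn_wrap.
  rewrite rotated0 //.
  have := @runs_extra (t - 12) N R Q P (q %% P) rho (rotated R Q rho q) (2 ^ (q %% l)) T (written out t).
  have vE : (if P <= (q %% P).+1 then 0 else (q %% P).+1) = q.+1 %% P.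
    have qP := ltn_pmod q (ltnW P_gt1).
    rewrite -[in RHS](addn1 q) -(modnDml q) addn1; case: leqP => h.
      by have -> : (q %% P).+1 = P; [apply/eqP; rewrite eqn_leq qP | rewrite modnn].
    by rewrite [RHS]modn_small.
  have two x : 2 ^ x + 2 ^ x = 2 ^ x.+1 by rewrite expnS mul2n addnn.
  have pE : (if N <= 2 ^ (q %% l) + 2 ^ (q %% l) then 1 else 2 ^ (q %% l) + 2 ^ (q %% l))
            = 2 ^ (q.+1 %% l).
    rewrite two -(addn1 q) -(modnDml q) addn1; have := ltn_pmod q l0.
    rewrite leq_eqVlt => /orP[/eqP->|lt].
      by rewrite modnn up_logP.
    rewrite [X in _ = 2 ^ X]modn_small // ifF //; apply/negbTE; apply: contraL lt => h.
    by rewrite -leqNgt; apply: up_log_min.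
  rewrite vE pE to => h; apply: runs_eq h _ _; last by lia.
  (* The power of two is below [N], so storing it unreduced is correct. *)
  rewrite written_succ // sv modn_small //.
  have := ltn_pmod q l0; apply: contraLR; rewrite -!leqNgt => h.
  exact: up_log_min.
apply: runs_eq.
- apply: runs_seq; first by apply: runs_if; rewrite guard; exact: branch.
  by apply: runs_asn.
- by rewrite /snapshot /state /= addn1.
- by rewrite /=; lia.
Qed.

Lemma runs_main out : runs cmd_main (snapshot out 12) (T.+1 * (120 * P + 310)) (snapshot out T).
Proof.
have T_ge : 12 <= T.
  rewrite -mulnA; apply: leq_trans (leq_pmulr _ _); first by lia.
  by rewrite muln_gt0 up_log_gt0 expn_gt0; lia.
apply: (runs_while (n := T - 12) (b := 120 * P + 300) (st := fun i => snapshot out (12 + i))).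
- by move=> i; rewrite /snapshot /state /=; lia.
- by move=> i _; exact: (runs_iteration out (leq_addr i 12)).
- by rewrite /snapshot /state /= subnKC // subnn.
- by rewrite addn0.
- by rewrite subnKC.
- by rewrite /= leq_mul //; lia.
Qed.

End MainLoop.

Definition cmd_clear : cmd :=
  asn 1 (EConst 0);; asn 2 (EConst 0);; asn 3 (EConst 0);; asn 4 (EConst 0);;
  asn 5 (EConst 0);; asn 6 (EConst 0);; asn 7 (EConst 0);; asn 8 (EConst 0);;
  asn 9 (EConst 0);; asn 10 (EConst 0);; asn 11 (EConst 0);; asn 12 (EConst 0).

Lemma runs_clear ptr N R Q P v rho x p T y z u out :
  runs cmd_clear (state ptr N R Q P v rho x p T y z u out) 40
    (state ptr 0 0 0 0 0 0 0 0 0 0 0 0 out).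
Proof. by straight. Qed.

(* The cells 1 to 12 of the variables also hold the first 12 items of the output.
   As 12 <= R, these are 0, since every rotation of the counter 0 is 0; the main
   loop starts at time 12 and the variables are cleared at the end. *)
Definition cmd_schedule (B R0 Q0 dR dQ : nat) : cmd :=
  asn 2 (EConst R0);; asn 3 (EConst Q0);; cmd_search B dR dQ;; cmd_total;;
  asn 5 (EConst 0);; asn 6 (EConst 12);; asn 7 (EConst 0);; asn 0 (EConst 12);;
  cmd_main;; cmd_clear.

Section Schedule.
Variables (B R0 Q0 dR dQ J N : nat).
Local Notation R := (R0 + J * dR).
Local Notation Q := (Q0 + J * dQ).
Local Notation P := (Q ^ R).
Local Notation l := (up_log 2 N).
Local Notation T := (R.+1 * P * l).
Hypotheses (N_gt1 : 1 < N) (Q0_gt1 : 1 < Q0) (R0_ge : 12 <= R0).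
Hypotheses (before : forall j, j < J -> (Q0 + j * dQ) ^ (R0 + j * dR) < B * N)
  (after : B * N <= P).

Definition schedule_time : nat :=
  J.+2 * (60 * (R.+1 * Q.+1) + 3 * B + 20) + 60 * l.+1 * R.+3 +
  T.+1 * (120 * P + 310) + 100.

Lemma runs_schedule (m : memory) : m 1 = N -> exists2 m',
  runs (cmd_schedule B R0 Q0 dR dQ) m schedule_time m' &
  m' 0 = T /\ forall t, t < T -> m' t.+1 = shift_value R Q l t %% N.
Proof.
move=> mN; pose out o := m (13 + o).
have Q_gt1 : 1 < Q by rewrite ltn_addr.
have R_ge : 12 <= R by rewrite ltn_addr.
have mE : m = state (m 0) N (m 2) (m 3) (m 4) (m 5) (m 6) (m 7) (m 8) (m 9) (m 10)
                (m 11) (m 12) out.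
  by apply/funext => a; rewrite -mN /state; do 13 ![case: a => [//|a]].
have main := runs_main N_gt1 Q_gt1 R_ge out.
rewrite (_ : snapshot N R Q out 12 = state 12 N R Q P 0 12 0 1 T 0 0 0 out) in main; last first.
  have R12 : 12 < R.+1 by [].
  rewrite /snapshot divn_small // !mod0n modn_small // rotated_zero.
  by congr state; apply/funext => o; rewrite /written subnn.
exists (state T 0 0 0 0 0 0 0 0 0 0 0 0 (written N R Q out T)).
  rewrite mE /cmd_schedule; apply: runs_le.
    step; step; apply: runs_seq; first by apply: (runs_search (J := J)).
    apply: runs_seq; first exact: runs_total.
    step; step; step; step; apply: runs_seq; first exact: main.
    exact: runs_clear.
  by rewrite /schedule_time /=; lia.
split=> // t tT; rewrite /state.
case: (ltnP t 12) => t12.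
  rewrite (_ : shift_value _ _ _ _ = 0); last first.
    by rewrite /shift_value divn_small ?modn_small ?rotated_zero ?ifT //; lia.
  by rewrite mod0n; move: t12 {tT}; do 12 ![case: t => [//|t]].
have -> : t.+1 = 13 + (t - 12) by lia.
by rewrite /= /written ltn_sub2r ?subnK //; lia.
Qed.

(** The output depends on the first input item only, so one program serves with and without a tape
    of coins. *)
Lemma computes_schedule (x : seq nat) : 0 < size x -> nth 0 x 0 = N ->
  computes_within (cmd_schedule B R0 Q0 dR dQ) x
    [seq nat_of_ord y | y <- rotation_schedule N R Q l] (schedule_time + T).
Proof.
move=> x0 xN; have [//|m [n nt ex] [m0 mt]] := @runs_schedule (store_list x).
exists n, m; split => //; last first.
  by rewrite size_map size_rotation_schedule leq_add2r.
apply: (@eq_from_nth _ 0).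
  by rewrite size_mkseq size_map size_rotation_schedule.
move=> t; rewrite size_mkseq m0 => tT; rewrite nth_mkseq ?m0 //= mt //.
rewrite (nth_map 0%R) ?size_rotation_schedule // (nth_map 0) ?size_iota // nth_iota //.
by rewrite val_Zp_nat.
Qed.

End Schedule.

(** * Polynomial running time and certification *)

Lemma first_above (f : nat -> nat) (c X : nat) :
  0 < X -> f 0 <= c -> (forall j, f j.+1 <= c * f j) -> X <= f X ->
  exists J, [/\ forall j, j < J -> f j < X, X <= f J, J <= X & f J <= c * X].
Proof.
move=> X0 f0 fS fX; have exj : exists j, X <= f j by exists X.
case: (ex_minnP exj) => J JX Jmin; exists J; split=> //.
- by move=> j; apply: contraTltn => /Jmin; rewrite -leqNgt.
- exact: Jmin.
case: J JX Jmin => [|J] JX Jmin; first by apply: leq_trans f0 _; rewrite leq_pmulr.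
(* By minimality the previous value is below [X], and one step multiplies it by at most [c]. *)
apply: leq_trans (fS J) _; rewrite leq_mul2l; apply/orP; right; apply: ltnW.
by rewrite ltnNge; apply/negP => /Jmin; rewrite ltnn.
Qed.

(** All quantities are at most [X = C' * N]; adding up coefficients bounds time and output length by
    [1101 * X ^ 4]. As [N >= 2], the constant [1101 * C' ^ 4] is at most [N] to that power, which
    accounts for the exponent. *)
Lemma schedule_time_poly (B R0 Q0 dR dQ C : nat) : exists k, forall N J,
  let R := R0 + J * dR in let Q := Q0 + J * dQ in
  1 < N -> 1 < Q -> 12 <= R -> J <= B * N -> Q ^ R <= C * N ->
  schedule_time B R0 Q0 dR dQ J N + R.+1 * Q ^ R * up_log 2 N <= poly_bound k N.
Proof.
pose C' := C + B + 4; exists (4 + 1101 * C' ^ 4) => N J R Q N_gt1 Q_gt1 R_ge JB PC.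
set l := up_log 2 N; set P := Q ^ R.
have RP : R < P by apply: leq_trans (ltn_expl R (isT : 1 < 2)) _; rewrite leq_exp2r //; lia.
have QP : Q <= P by apply: Q_le_P.
have lN : l <= N by apply: up_log_min => //; apply: ltnW; apply: ltn_expl.
pose X := C' * N.
have BN : B <= B * N by rewrite leq_pmulr //; lia.
have bounds : [/\ J.+2 <= X, R.+3 <= X, Q.+1 <= X, P <= X & l.+1 <= X].
  have -> : X = C * N + B * N + 4 * N by rewrite /X /C' !mulnDl.
  by split; lia.
case: bounds => JX RX QX PX lX.
have BX : 3 * B + 20 <= 20 * X by rewrite /X /C' !mulnDl; lia.
have X3 : 3 <= X by lia.
rewrite /poly_bound; apply: leq_trans (leq_addr _ _).
apply: (@leq_trans (1101 * X ^ 4)).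
  have TX : R.+1 * P * l <= X ^ 3.
    by rewrite !expnS expn0 muln1 mulnA; apply: leq_mul; [apply: leq_mul|]; lia.
  have h1 : J.+2 * (60 * (R.+1 * Q.+1) + 3 * B + 20) <= X * (60 * (X * X) + 20 * X).
    apply: leq_mul => //; rewrite -addnA leq_add // leq_mul2l /=.
    by apply: leq_mul; lia.
  have h2 : 60 * l.+1 * R.+3 <= 60 * X * X by rewrite leq_mul // leq_mul2l.
  have h3 : (R.+1 * P * l).+1 * (120 * P + 310) <= (X ^ 3).+1 * (120 * X + 310).
    by apply: leq_mul; lia.
  have e1 : X <= X ^ 4 by rewrite -{1}[X]expn1 leq_exp2l //; lia.
  have e2 : X ^ 2 <= X ^ 4 by rewrite leq_exp2l //; lia.
  have e3 : X ^ 3 <= X ^ 4 by rewrite leq_exp2l //; lia.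
  rewrite /schedule_time -/R -/Q -/P -/l.
  have -> : 1101 * X ^ 4 = 60 * X ^ 4 + 20 * X ^ 4 + 60 * X ^ 4 + 120 * X ^ 4 +
    310 * X ^ 4 + 120 * X ^ 4 + 410 * X ^ 4 + X ^ 4 by ring.
  have a1 : X * (60 * (X * X) + 20 * X) = 60 * X ^ 3 + 20 * X ^ 2 by ring.
  have a2 : 60 * X * X = 60 * X ^ 2 by ring.
  have a3 : (X ^ 3).+1 * (120 * X + 310) = 120 * X ^ 4 + 310 * X ^ 3 + 120 * X + 310 by ring.
  move: h1 h2 h3; rewrite a1 a2 a3 => h1 h2 h3.
  by move: (X ^ 2) (X ^ 3) (X ^ 4) e1 e2 e3 TX h1 h2 h3 => Y Z W *; lia.
rewrite /X expnMn mulnA expnD mulnC leq_mul2l; apply/orP; right.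
exact: ltnW (ltn_expl _ N_gt1).
Qed.

Definition cmd_accept : cmd := CSeq (CStore (EConst 1) (EConst 1)) (CStore (EConst 0) (EConst 1)).

(** Two stores of cost 3 each, and 1 for the length of the output. *)
Lemma accept_computes x t : 7 <= t -> computes_within cmd_accept x [:: 1] t.
Proof.
move=> t7; exists 6, [eta [eta store_list x with 1 |-> 1] with 0 |-> 1]; split=> //.
by rewrite -[6]/(3 + 3); apply: exec_seq; apply: exec_store.
Qed.

Lemma certified_of_computed (A : cmd) (k N : nat) (s : seq 'Z_N) (good : seq 'Z_N -> Prop) :
  s != [::] -> 7 <= poly_bound k N ->
  (forall x, 0 < size x -> nth 0 x 0 = N ->
     computes_within A x [seq nat_of_ord y | y <- s] (poly_bound k N)) ->
  good s -> certified_random_schedule A cmd_accept k good.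
Proof.
move=> s0 k7 comp gs; exists (fun=> s), [set: _]; split=> //.
- by move=> r; split=> //; apply: comp.
- by move=> r; rewrite inE; apply: accept_computes.
rewrite cardsT divff ?invf_le1 // ?ler1n //.
by rewrite pnatr_eq0 -lt0n card_tuple expn_gt0 card_bool.
Qed.

(** * Latency and throughput bounds *)

Local Open Scope ring_scope.

Section Bounds.
Variable K : realType.

(** One half of [eps] pays for [1 / B] and the other for [R.+1 / R], as both [eps * B] and [eps * R]
    are at least 2. [h'] is the number of rows actually sampled. *)
Lemma throughput_bound (eps : K) (h h' B R : nat) :
  (0 < h)%N -> (h' <= h)%N -> (0 < B)%N -> 2 <= eps * B%:R -> (B <= R)%N ->
  (2 * h%:R)^-1 * (1 - eps) * (2 * h'%:R * R.+1%:R) <= R%:R * (1 - B%:R^-1).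
Proof.
move=> h0 hh B0 eB BR.
have B0' : 0 < B%:R :> K by rewrite ltr0n.
have h0' : 0 < h%:R :> K by rewrite ltr0n.
have BR' : B%:R <= R%:R :> K by rewrite ler_nat.
have e0 : 0 < eps by rewrite -(pmulr_lgt0 _ B0'); lra.
have iB : B%:R^-1 <= eps / 2 by rewrite -[leLHS]mul1r ler_pdivrMr //; lra.
have eR : 2 <= eps * R%:R by apply: le_trans eB _; rewrite ler_pM2l.
have rhs : R%:R * (1 - eps / 2) <= R%:R * (1 - B%:R^-1).
  by rewrite ler_wpM2l ?ler0n // lerB.
have -> : (2 * h%:R)^-1 * (1 - eps) * (2 * h'%:R * R.+1%:R) =
          (h'%:R / h%:R) * ((1 - eps) * R.+1%:R) by field; rewrite gt_eqF.
have q0 : 0 <= h'%:R / h%:R :> K by rewrite divr_ge0.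
have q1 : h'%:R / h%:R <= 1 :> K by rewrite ler_pdivrMr // mul1r ler_nat.
have main : (1 - eps) * R.+1%:R <= R%:R * (1 - eps / 2).
  by rewrite -natr1; move: (R%:R : K) eR => x eR; nra.
have rhs0 : 0 <= R%:R * (1 - B%:R^-1) :> K.
  by rewrite mulr_ge0 // subr_ge0 invf_le1 // ler1n.
(* For [eps >= 1] the left side is not positive, and [h' / h <= 1] cannot be used. *)
have [neg|pos] := lerP ((1 - eps) * R.+1%:R) 0.
  by apply: le_trans rhs0; rewrite mulr_ge0_le0.
apply: le_trans rhs; apply: le_trans main; rewrite -[leRHS]mul1r.
by rewrite ler_wpM2r // ltW.
Qed.

Lemma root_bound (h x c N : nat) : (0 < h)%N -> (x ^ h <= c ^ h * N)%N ->
  x%:R <= c%:R * N%:R `^ (h%:R^-1) :> K.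
Proof.
move=> h0 xN; rewrite -(@ler_pXn2r _ h) // ?nnegrE ?mulr_ge0 ?powR_ge0 //.
rewrite exprMn -(powR_mulrn h (powR_ge0 _ _)) -powRrM mulVf ?pnatr_eq0 -?lt0n //.
by rewrite powRr1 // -!natrX -natrM ler_nat.
Qed.

Lemma Lstar_ge_root (h N : nat) : (0 < h)%N -> N%:R `^ (h%:R^-1) <= Lstar K h N.
Proof. by move=> h0; rewrite /Lstar ler_peMl ?powR_ge0 // ler1n. Qed.

(** [N ^ (1 / h)] is the exponential of [ln N / h], hence at least [1 + ln N / h]. *)
Lemma Lstar_ge_ln (h N : nat) : (0 < h)%N -> (0 < N)%N -> ln N%:R <= Lstar K h N.
Proof.
move=> h0 N0; have h0' : 0 < h%:R :> K by rewrite ltr0n.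
rewrite /Lstar /powR pnatr_eq0 -leqn0 leqNgt N0 /= mulrC -ler_pdivrMr // mulrC.
by apply: le_trans (expR_ge1Dx _); rewrite lerDr.
Qed.

(** As [c < N ^ c], the hypothesis gives [2 ^ m <= N ^ c.+1]; take logarithms. *)
Lemma exponent_le_ln (m c N : nat) : (1 < N)%N -> (2 ^ m <= c * N)%N ->
  m%:R <= (c.+1)%:R / ln 2 * ln N%:R :> K.
Proof.
move=> N1 mc; have l2 : 0 < ln 2 :> K by rewrite ln_gt0 // ltr1n.
rewrite mulrAC ler_pdivlMr //.
have N0 : 0 < N%:R :> K by rewrite ltr0n ltnW.
rewrite !mulr_natl -!lnXn //.
rewrite ler_ln ?posrE ?exprn_gt0 // -!natrX ler_nat.
apply: leq_trans mc _; rewrite expnSr leq_mul2r; apply/orP; right.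
exact: ltnW (ltn_expl _ N1).
Qed.

Lemma ln2_le (N : nat) : (1 < N)%N -> 1 <= ln N%:R / ln 2 :> K.
Proof.
move=> N1; have l2 : 0 < ln 2 :> K by rewrite ln_gt0 // ltr1n.
by rewrite ler_pdivlMr // mul1r ler_ln ?posrE ?ltr0n ?ler_nat // ltnW.
Qed.

End Bounds.

Definition computable_in (A : cmd) (k N : nat) (s : seq 'Z_N) : Prop :=
  forall x, (0 < size x)%N -> nth 0%N x 0 = N ->
    computes_within A x [seq nat_of_ord y | y <- s] (poly_bound k N).

(** Treats the search over [R] and the search over [Q] together. One step multiplies [Q ^ R] by at
    most [2 ^ R0], so the first value reaching [B * N] overshoots by at most this factor. *)
Lemma rotation_schedule_computable (B R0 dR dQ : nat) :
  (0 < B)%N -> (12 <= R0)%N -> (0 < dR + dQ)%N ->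
  (forall j, (2 + j.+1 * dQ) ^ (R0 + j.+1 * dR) <=
             2 ^ R0 * (2 + j * dQ) ^ (R0 + j * dR))%N ->
  exists k, forall N, (1 < N)%N -> exists R Q,
    [/\ exists J, (R = R0 + J * dR /\ Q = 2 + J * dQ)%N,
        (B * N <= Q ^ R)%N, (Q ^ R <= 2 ^ R0 * B * N)%N, (7 <= poly_bound k N)%N &
        computable_in (cmd_schedule B R0 2 dR dQ) k (rotation_schedule N R Q (up_log 2 N))].
Proof.
move=> B0 R0_ge d0 growth.
have [k kP] := schedule_time_poly B R0 2 dR dQ (2 ^ R0 * B).
exists k => N N1.
pose f j := ((2 + j * dQ) ^ (R0 + j * dR))%N.
have X0 : (0 < B * N)%N by rewrite muln_gt0 B0 ltnW.
have fX : (B * N <= f (B * N))%N.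
  rewrite /f; set X := (B * N)%N.
  case: dQ d0 {growth kP f} => [|dQ] d0.
    apply: leq_trans (ltnW (ltn_expl _ (isT : (1 < 2)%N))) _.
    rewrite muln0 addn0 leq_exp2l //; apply: leq_trans (leq_addl _ _).
    by rewrite leq_pmulr //; lia.
  apply: (@leq_trans ((2 + X * dQ.+1) ^ 1)); first by rewrite expn1; nia.
  by rewrite leq_exp2l //; lia.
have f0 : (f 0 <= 2 ^ R0)%N by rewrite /f !mul0n !addn0.
have [J [before after JX fJ]] := first_above X0 f0 growth fX.
exists (R0 + J * dR)%N, (2 + J * dQ)%N.
have Q1 : (1 < 2 + J * dQ)%N by [].
have R1 : (12 <= R0 + J * dR)%N by rewrite ltn_addr.
have fJ' : (f J <= 2 ^ R0 * B * N)%N by rewrite -mulnA.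
have time := kP N J N1 Q1 R1 JX fJ'.
split => //; first by exists J.
  by apply: leq_trans time; rewrite /schedule_time; lia.
move=> x x0 xN; have [n [m [ex rd le]]] :=
  computes_schedule N1 (isT : (1 < 2)%N) R0_ge before after x0 xN.
by exists n, m; split => //; apply: leq_trans time.
Qed.

Lemma rotation_schedule_neq0 N R Q : (1 < N)%N -> (0 < Q)%N ->
  rotation_schedule N R Q (up_log 2 N) != [::].
Proof.
move=> N1 Q0; rewrite -size_eq0 size_rotation_schedule -lt0n !muln_gt0 expn_gt0 Q0 /=.
by rewrite up_log_gt0.
Qed.

(** * The schedules for multiplicative and additive error *)

Section Tradeoffs.
Variables (K : realType) (eps : K) (B : nat).
Hypotheses (B_ge : (12 <= B)%N) (epsB : 2 <= eps * B%:R).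

Lemma multiplicative_tradeoff : exists (A : cmd) (k : nat) (C : K),
  forall N, (1 < N)%N -> exists s : seq 'Z_N,
  [/\ s != [::], (7 <= poly_bound k N)%N, computable_in A k s &
      universal_tradeoff s (fun h => (2 * h%:R)^-1 * (1 - eps))
        (fun h => C * (Lstar K h N * ln N%:R))].
Proof.
have [||||k kP] := @rotation_schedule_computable B B 1 0; try lia.
  have B2 : (2 ^ 1 <= 2 ^ B)%N by rewrite leq_exp2l //; lia.
  by move=> j; rewrite !muln0 !addn0 !muln1 addnS expnS leq_mul2r B2 orbT.
(* Chosen so that [2 ^ (w * h) <= 2 ^ h * 2 ^ R <= c ^ h * N], which bounds [2 ^ w] by
   [c * N ^ (1 / h)]. *)
pose c := (2 * (2 ^ B * B))%N.
pose C := 3 * (((c.+1)%:R / ln 2) + (ln 2)^-1) * c%:R : K.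
exists (cmd_schedule B B 2 1 0), k, C => N N1.
have [R [Q [[J [RE QE]] BN PN k7 comp]]] := kP N N1.
rewrite muln1 in RE; rewrite muln0 addn0 in QE; subst Q.
exists (rotation_schedule N R 2 (up_log 2 N)); split=> //.
  exact: rotation_schedule_neq0.
move=> h /andP[h0 hN].
have hR : (h <= R)%N.
  rewrite -(@leq_exp2l 2) //; apply: leq_trans BN; apply: (@leq_trans N).
    by rewrite (leq_trans _ (trunc_logP (isT : (1 < 2)%N) (ltnW N1))) // leq_exp2l.
  by rewrite leq_pmull //; lia.
have R0 : (0 < R)%N by lia.
have l0 : (0 < up_log 2 N)%N by rewrite up_log_gt0.
(* [w] is [R / h] rounded up and [h'] is [R / w] rounded up; then [h' <= h], and [h'] rows cover all
   places while [h'.-1] do not. *)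
pose w := (R.-1 %/ h).+1; pose h' := (R.-1 %/ w).+1.
have wR : (w <= R)%N by have := leq_div R.-1 h; rewrite /w; lia.
have hw : (R <= h' * w)%N.
  by have := @ltn_ceil R.-1 w isT; rewrite -/h'; move: (h' * w)%N => z; lia.
have hw' : (h'.-1 * w < R)%N.
  by have := leq_trunc_div R.-1 w; rewrite /h' /=; lia.
have h'h : (h' <= h)%N.
  by rewrite /h' ltn_divLR // /w mulnC ltn_ceil.
have wh : (w * h <= R + h)%N.
  by rewrite /w mulSn addnC; have := leq_trunc_div R.-1 h; lia.
have [f [f1 f2 f3]] := @rotation_routing K N R 2 (up_log 2 N) w h' B N1 isT l0
  R0 isT wR hw hw' (ltac:(lia)) BN.
exists f; split=> //.
  by apply: f2; apply: throughput_bound => //; lia.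
apply: le_trans f3 _; rewrite lee_fin.
have root : (2 ^ w)%:R <= c%:R * N%:R `^ (h%:R^-1) :> K.
  apply: root_bound => //; rewrite -expnM; apply: (@leq_trans (2 ^ h * 2 ^ R)).
    by rewrite -expnD addnC leq_exp2l.
  rewrite /c expnMn -mulnA leq_mul2l; apply/orP; right; apply: leq_trans PN _.
  rewrite leq_mul2r -{1}[(2 ^ B * B)%N]expn1 leq_exp2l ?h0 ?orbT //.
  by apply: leq_trans (leq_pmull _ _); rewrite ?expn_gt0 //; lia.
have Rln : R.+1%:R <= (c.+1%:R / ln 2 + (ln 2)^-1) * ln N%:R :> K.
  rewrite -natr1 mulrDl lerD //; last by rewrite mulrC ln2_le.
  apply: exponent_le_ln => //; apply: leq_trans PN _.
  by rewrite /c -mulnA mulnA leq_mul2r; lia.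
rewrite !natrM.
have -> : C * (Lstar K h N * ln N%:R) =
  3 * (((c.+1%:R / ln 2 + (ln 2)^-1) * ln N%:R) * (c%:R * Lstar K h N)).
  by rewrite /C; move: (Lstar _ _ _) (ln N%:R) (ln 2)^-1 => *; ring.
rewrite ler_pM2l // ler_pM // (le_trans root) // ler_wpM2l //.
exact: Lstar_ge_root.
Qed.

(** The constant [B]! is divisible by every [h <= B], and only [Q] grows with [N]. For [h > B] the
    throughput to be guaranteed is negative because [eps * B >= 2]. *)
Lemma additive_tradeoff : exists (A : cmd) (k : nat) (C : K),
  forall N, (1 < N)%N -> exists s : seq 'Z_N,
  [/\ s != [::], (7 <= poly_bound k N)%N, computable_in A k s &
      universal_tradeoff s (fun h => (2 * h%:R)^-1 - eps) (fun h => C * Lstar K h N)].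
Proof.
have fB : (B <= B`!)%N.
  by rewrite -(prednK (ltac:(lia) : (0 < B)%N)) factS leq_pmulr // fact_gt0.
have [||||k kP] := @rotation_schedule_computable B B`! 0 1; try lia.
  move=> j; rewrite !muln0 !addn0 !muln1 -expnMn leq_exp2r ?fact_gt0 //.
  by rewrite mulnDr; lia.
pose R := B`!; pose c := (2 ^ R * B)%N.
have l2 : 0 < ln 2 :> K by rewrite ln_gt0 // ltr1n.
(* [c] serves the main rows; [3 / ln 2] compares [up_log 2 N] with [ln N], the 3 being 2 + 1 from
   [2 ^ up_log 2 N <= 2 * N]. *)
pose C := 3 * R.+1%:R * (c%:R + 3 / ln 2) : K.
exists (cmd_schedule B B`! 2 0 1), k, C => N N1.
have [R' [Q [[J [RE QE]] BN PN k7 comp]]] := kP N N1.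
rewrite muln0 addn0 in RE; rewrite muln1 in QE; subst R'.
have Q0 : (0 < Q)%N by rewrite QE.
have R0 : (0 < R)%N by exact: fact_gt0.
have l0 : (0 < up_log 2 N)%N by rewrite up_log_gt0.
exists (rotation_schedule N R Q (up_log 2 N)); split=> //.
  exact: rotation_schedule_neq0.
have B0 : 0 < B%:R :> K by rewrite ltr0n; lia.
have eps0 : 0 < eps by rewrite -(pmulr_lgt0 _ B0); apply: lt_le_trans epsB.
move=> h /andP[h0 hN]; have h0' : 0 < h%:R :> K by rewrite ltr0n.
have L0 : 0 <= Lstar K h N by rewrite mulr_ge0 ?powR_ge0.
have [hB|Bh] := leqP h B.
  have hR : (h %| R)%N by rewrite dvdn_fact ?h0.
  have wR : (R = h * (R %/ h))%N by rewrite mulnC divnK.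
  have w0 : (0 < R %/ h)%N by rewrite divn_gt0 // dvdn_leq.
  have [f [f1 f2 f3]] := @rotation_routing K N R Q (up_log 2 N) (R %/ h) h B N1 Q0
    l0 R0 w0 (leq_div _ _) (eq_leq wR)
    (ltac:(rewrite {2}wR ltn_pmul2r //; lia)) (ltac:(lia)) BN.
  exists f; split=> //.
    (* This makes the additive bound weaker than the multiplicative one. *)
    have i1 : (2 * h%:R)^-1 <= 1 :> K.
      by rewrite invf_le1 ?mulr_gt0 // -natrM ler1n muln_gt0.
    apply: f2; apply: le_trans (_ : (2 * h%:R)^-1 * (1 - eps) * (2 * h%:R * R.+1%:R) <= _).
      rewrite ler_wpM2r ?mulr_ge0 // mulrBr mulr1 lerB //.
      by rewrite ler_piMl // ltW.
    by apply: throughput_bound => //; lia.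
  apply: le_trans f3 _; rewrite lee_fin !natrM /C -!mulrA ler_pM2l // ler_pM2l ?ltr0n //.
  apply: (@le_trans _ _ (c%:R * N%:R `^ (h%:R^-1))).
    apply: root_bound => //; rewrite -expnM divnK //; apply: leq_trans PN _.
    rewrite leq_mul2r -{1}[(2 ^ B`! * B)%N]expn1 leq_exp2l ?h0 ?orbT //.
    by apply: leq_trans (leq_pmull _ _); rewrite ?expn_gt0 //; lia.
  apply: ler_pM => //; rewrite ?powR_ge0 ?Lstar_ge_root // lerDl.
  by rewrite divr_ge0 // ltW.
have [f [f1 f2 f3]] := @power_routing K N R Q (up_log 2 N) N1 Q0 l0 (@up_logP 2 N isT).
exists f; split=> //.
  apply: f2; rewrite subr_le0 -[leLHS]mul1r ler_pdivrMr ?mulr_gt0 //.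
  have : eps * B%:R <= eps * h%:R by rewrite ler_pM2l // ler_nat ltnW.
  by move: epsB; move: (h%:R : K) => x; lra.
apply: le_trans f3 _; rewrite lee_fin !natrM /C -!mulrA ler_pM2l // ler_pM2l ?ltr0n //.
have lle : (up_log 2 N)%:R <= 3 / ln 2 * ln N%:R :> K.
  apply: (@exponent_le_ln K (up_log 2 N) 2 N) => //.
  have [l' l'E] : exists l', up_log 2 N = l'.+1.
    by exists (up_log 2 N).-1; rewrite prednK // up_log_gt0.
  rewrite l'E expnS leq_mul2l /=; apply: ltnW; rewrite ltnNge; apply/negP.
  by move/(up_log_min (isT : (1 < 2)%N)); rewrite l'E ltnn.
apply: le_trans lle _; apply: ler_pM => //.
- by rewrite divr_ge0 // ltW.
- by rewrite ln_ge0 // ler1n ltnW.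
- by rewrite lerDr.
- by apply: Lstar_ge_ln => //; apply: ltnW.
Qed.

End Tradeoffs.

Theorem theorem1 (R : realType) (eps : R) (heps : 0 < eps) :
  (exists (A C : cmd) (k N0 p : nat) (K : R),
     forall N : nat, (1 < N)%N -> (N0 <= N)%N ->
       certified_random_schedule A C k (fun s : seq 'Z_N =>
         universal_tradeoff s
           (fun h => (2 * h%:R)^-1 * (1 - eps))
           (fun h => K * (Lstar R h N * ln (N%:R : R) ^+ p)))) /\
  (exists (A C : cmd) (k N0 : nat) (K : R),
     forall N : nat, (1 < N)%N -> (N0 <= N)%N ->
       certified_random_schedule A C k (fun s : seq 'Z_N =>
         universal_tradeoff s
           (fun h => (2 * h%:R)^-1 - eps)
           (fun h => K * Lstar R h N))) /\
  (exists (A : cmd) (k : nat) (K : R),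
     forall N0 : nat, exists N : nat,
       [/\ (1 < N)%N, (N0 <= N)%N &
         computed_schedule A k (fun s : seq 'Z_N =>
           universal_tradeoff s
             (fun h => (2 * h%:R)^-1 * (1 - eps))
             (fun h => K * (Lstar R h N * ln (N%:R : R))))]).
Proof.
have [B B_ge epsB] : exists2 B, (12 <= B)%N & 2 <= eps * B%:R.
  (* The 12 makes [R >= 12], so that the items sharing cells with the variables are 0; the rest
     gives [eps * B >= 2]. *)
  exists (12 + (Num.truncn (2 / eps)).+1)%N; first exact: leq_addr.
  rewrite mulrC -ler_pdivrMr //; apply: le_trans (ltW (truncnS_gt (2 / eps))) _.
  by rewrite ler_nat leq_addl.
have [A1 [k1 [C1 mult]]] := multiplicative_tradeoff B_ge epsB.
have [A2 [k2 [C2 add]]] := additive_tradeoff B_ge epsB.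
split; [|split].
- exists A1, cmd_accept, k1, 0%N, 1%N, C1 => N N1 _.
  have [s [s0 k7 comp good]] := mult N N1.
  exact: (certified_of_computed s0 k7 comp).
- exists A2, cmd_accept, k2, 0%N, C2 => N N1 _.
  have [s [s0 k7 comp good]] := add N N1.
  exact: (certified_of_computed s0 k7 comp).
(* The program of the first part is deterministic and loses a single factor [ln N], so it also
   proves the third part. *)
exists A1, k1, C1 => N0; exists N0.+2; split; [by [] | by lia |].
have [s [s0 k7 comp good]] := mult N0.+2 isT.
by exists s; split=> //; exact: (comp [:: N0.+2]).
Qed.
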